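(* There exist universal constants $c, C > 0$ such that the following holds along every sequence of triples $(n,N,m)$ with $n, N, m \to \infty$, for all sufficiently large indices in the sequence, for any fixed $\theta \in \mathcal{S}^{n-1}$ and any $\epsilon \in (0,1)$: (i) If $\beta = o(1)$, then with probability at least $1 - \epsilon^{-2} e^{-c \log m} - 2 e^{-c n \epsilon^2}$, we have $$\big| \log \|X\theta\| - Z \big| \;\le\; C\Big( \frac{\epsilon}{1-\epsilon} + \frac{\beta^2 \log m}{n} \Big).$$ (ii) If $\beta = \Omega(1)$, $\log m = o(N^{1/3})$ and $N = o(n^3)$, then with probability at least $1 - (1+\epsilon^{-2}) e^{-c (\log m)^{3/4}} - 2 e^{-c n \epsilon^2}$, we have $$\frac{1}{\beta^2 \log m} \big| \log \|X\theta\| - Z \big| \;\le\; C\Big( \frac{\epsilon}{(1-\epsilon)\,\beta \log m} + \frac{1}{\beta (\log m)^{1/4}} \Big).$$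
   Context: For integers $n, N, m$, let $X_{ij}$ ($1\le i\le m$, $1\le j\le N$) be i.i.d. random $n\times n$ real matrices, each with i.i.d. $\mathcal{N}(0, n^{-1})$ entries, and set $$X := \frac{1}{\sqrt m}\sum_{i=1}^m X_i, \qquad X_i := X_{iN}X_{i(N-1)}\cdots X_{i1}.$$ $\mathcal{S}^{n-1}\subset\mathbb{R}^n$ is the Euclidean unit sphere and $\|\cdot\|$ is the Euclidean norm. Define $$\beta := \frac{\sqrt{2(N-1)}}{\sqrt{n\log m}}, \qquad Z := \begin{cases} 0 & \text{if } \beta\le\sqrt2,\\ -\dfrac{(\beta-\sqrt2)^2}{4}\,\log m & \text{if } \beta>\sqrt2.\end{cases}$$ Asymptotic convention: $n, N, m\to\infty$ simultaneously (along a sequence), and $o(\cdot)$, $\Omega(\cdot)$ refer to this limit; thus $\beta=o(1)$ means $\beta\to0$ along the sequence, and $\beta=\Omega(1)$ means $\beta$ is bounded below by a positive constant along the sequence. ''Sufficiently large'' is uniform in $\epsilon$ and $\theta$. *)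

(* Defs.v *)
From HB Require Import structures.
From mathcomp Require Import all_boot all_order all_algebra.
From mathcomp Require Import all_classical all_reals all_analysis.

Set Implicit Arguments.
Unset Strict Implicit.
Unset Printing Implicit Defensive.

Import Order.TTheory GRing.Theory Num.Theory.
Import numFieldNormedType.Exports.

Local Open Scope classical_set_scope.
Local Open Scope ring_scope.

Definition mutually_independent d (T : measurableType d) (R : realType)
    (P : probability T R) (I : finType) (X : I -> {RV P >-> R}) : Prop :=
  forall (J : {set I}) (B : I -> set R), (forall i, measurable (B i)) ->
    P (\bigcap_(i in [set i | i \in J]) (X i @^-1` B i)) =
    (\prod_(i in J) P (X i @^-1` B i))%E.

(* The norm that MathComp-Analysis puts on matrices is the sup norm. *)
Definition eucl_norm (R : realType) (n : nat) (v : 'cV[R]_n) : R :=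
  Num.sqrt (\sum_(a < n) v a 0 ^+ 2).

(* [W i j a b] is the (a, b) entry of the matrix X_ij. Independence of the
   matrices together with independence of the entries within each matrix amounts
   to mutual independence of all the entries. The second parameter of
   [normal_prob] is the standard deviation, so the variance is 1 / n. *)
Definition gaussian_matrices d (T : measurableType d) (R : realType)
    (P : probability T R) (n N m : nat)
    (W : 'I_m -> 'I_N -> 'I_n -> 'I_n -> {RV P >-> R}) : Prop :=
  (forall i j a b (B : set R), measurable B ->
     distribution P (W i j a b) B = normal_prob 0 (Num.sqrt n%:R^-1) B) /\
  mutually_independent
    (fun q : 'I_m * 'I_N * 'I_n * 'I_n => W q.1.1.1 q.1.1.2 q.1.2 q.2).

Section ProductSum.
Context d (T : measurableType d) (R : realType) (P : probability T R).
Context (n N m : nat) (W : 'I_m -> 'I_N -> 'I_n -> 'I_n -> {RV P >-> R}).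

Definition factor (i : 'I_m) (j : 'I_N) (w : T) : 'M[R]_n :=
  \matrix_(a, b) W i j a b w.

(* [rev_ord] puts the factor with the largest index leftmost. *)
Definition factor_prod (i : 'I_m) (w : T) : 'M[R]_n :=
  \big[mulmx/1%:M]_(j < N) factor i (rev_ord j) w.

Definition prod_sum (w : T) : 'M[R]_n :=
  (Num.sqrt m%:R)^-1 *: \sum_(i < m) factor_prod i w.

End ProductSum.

(* The subtraction is in R, not the truncated one on nat. *)
Definition beta_param (R : realType) (n N m : nat) : R :=
  Num.sqrt (2 * (N%:R - 1)) / Num.sqrt (n%:R * ln m%:R).

Definition Z_limit (R : realType) (n N m : nat) : R :=
  let b := beta_param R n N m in
  if b <= Num.sqrt 2 then 0 else - ((b - Num.sqrt 2) ^+ 2 / 4 * ln m%:R).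

(* Main.v *)
(** Conditionally on the first [N - 1] factors, [X theta] is a centred Gaussian
    vector, so [|X theta|^2] is the product of a normalized chi-square variable
    and of the energy [(1/m) \sum_i Y_i], where [Y_i] is the squared norm of
    [X_i(N-1) ... X_i1 theta].  The [Y_i] are independent, and each is a product
    of [N - 1] independent normalized chi-square variables, so its logarithm
    behaves like a Gaussian of mean [- V / 2] and variance
    [V = 2 (N - 1) / n = beta^2 log m]: the energy is the partition function of
    a random energy model at inverse temperature [beta].

    For small [beta] Chebyshev's inequality applies, since [E Y_i = 1] and
    [E Y_i^2 <= exp V].  Otherwise let [g = min beta (sqrt 2)].  The upper bound
    is Markov's inequality for the moment of order [g / beta] of the energy.  For
    the lower bound, tilting the law of [Y_i] by [Y_i^s] with [s] slightly below
    [g / beta] bounds from below the probability that [Y_i] reaches the dominant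
    level, and Chebyshev's inequality bounds the number of indices that reach it.

    Both bounds need [E u^s] for [0 <= s <= 1] and [u] a normalized chi-square
    variable up to a factor [exp (O (s / n^2 + 1 / n^3))].  This follows from the
    first moments of [u] and a cubic Taylor polynomial of [u^s] at [1], which is an
    upper bound, and becomes a lower bound once [s (u - 1)^4 + 64 (u - 1)^6] is
    subtracted from it. The condition [N = o(n^3)] makes the accumulated error
    negligible. *)
Require Import Defs.
From HB Require Import structures.
From mathcomp Require Import all_boot all_order all_algebra.
From mathcomp Require Import all_classical all_reals all_analysis.
From mathcomp Require Import measurable_realfun.
From mathcomp Require Import ring lra.
Set Implicit Arguments.
Unset Strict Implicit.
Unset Printing Implicit Defensive.
Import Order.TTheory GRing.Theory Num.Theory.
Import numFieldNormedType.Exports.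
Local Open Scope classical_set_scope.
Local Open Scope ring_scope.

(** * Decoupling of disjoint families of independent variables *)

Section Decoupling.
Context d (T : measurableType d) (R : realType) (P : probability T R).
Context (I : finType) (W : I -> {RV P >-> R}).

Implicit Types J K : {set I}.

(** Events that constrain only the coordinates in [J]. They are stable under intersection and
    generate the sigma-algebra of these coordinates. *)
Definition cylinder J : set (set T) :=
  [set A | exists2 B : I -> set R, (forall i, measurable (B i)) &
     A = \bigcap_(i in [set i | i \in J]) (W i @^-1` B i)].

(* The sample space equipped with the sub-sigma-algebra generated by [W i],
   [i \in J]. *)
Definition coarse J := g_sigma_algebraType (cylinder J).

HB.instance Definition _ J := Measurable.on (coarse J).

Lemma cylinder_measurable J : cylinder J `<=` measurable.
Proof.
move=> _ [B mB ->]; apply: fin_bigcap_measurable; first exact: finite_finset.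
by move=> i _; exact: measurable_funPTI.
Qed.

Lemma cylinderT J : cylinder J setT.
Proof.
exists (fun=> setT) => //.
by apply/seteqP; split.
Qed.

Lemma cylinder_setI J : setI_closed (cylinder J).
Proof.
move=> _ _ [B mB ->] [B' mB' ->]; exists (fun i => B i `&` B' i).
  by move=> i; exact: measurableI.
by rewrite -bigcapI; apply: eq_bigcapr.
Qed.

Lemma cylinderS (J J' : {set I}) : J \subset J' -> cylinder J `<=` cylinder J'.
Proof.
move=> sJ _ [B mB ->]; exists (fun i => if i \in J then B i else setT).
  by move=> i; case: ifP.
apply/seteqP; split=> w Bw i /= iJ.
  by case: ifPn => // iJ'; exact: Bw.
by have := Bw i (fintype.subsetP sJ _ iJ); rewrite iJ.
Qed.

Lemma coarse_measurable J (A : set T) :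
  measurable (A : set (coarse J)) -> measurable A.
Proof. by move: A; apply: smallest_sub; [exact: sigma_algebra_measurable|exact: cylinder_measurable]. Qed.

Lemma coarse_measurableS (J J' : {set I}) (A : set T) : J \subset J' ->
  measurable (A : set (coarse J)) -> measurable (A : set (coarse J')).
Proof. by move=> /cylinderS sJ; exact: sub_smallest2r. Qed.

Lemma measurable_coarse d' (U : measurableType d') J (f : T -> U) :
  measurable_fun setT (f : coarse J -> U) -> measurable_fun setT f.
Proof.
move=> mf _ B mB; rewrite setTI; apply: (@coarse_measurable J).
by rewrite -[X in measurable X]setTI; exact: mf.
Qed.

Lemma measurable_coarseS d' (U : measurableType d') (J J' : {set I}) (f : T -> U) :
  J \subset J' -> measurable_fun setT (f : coarse J -> U) ->
  measurable_fun setT (f : coarse J' -> U).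
Proof.
move=> sJ mf _ B mB; rewrite setTI; apply: (coarse_measurableS sJ).
by rewrite -[X in measurable X]setTI; exact: mf.
Qed.

Lemma measurable_coord J i : i \in J ->
  measurable_fun setT (W i : coarse J -> R).
Proof.
move=> iJ _ B mB; rewrite setTI; apply: sub_sigma_algebra.
exists (fun j => if j == i then B else setT); first by move=> j; case: ifP.
apply/seteqP; split=> [w Bw j /= jJ|w /(_ i iJ)]; last by rewrite eqxx.
by case: eqP => // ->.
Qed.

Hypothesis indepW : mutually_independent W.

(** As [J] and [K] are disjoint, the two intersections merge into one over [J :|: K], to which
    mutual independence applies directly. *)
Lemma cylinder_indep J K A B : {in J, forall i, i \notin K} -> cylinder J A ->
  cylinder K B -> P (A `&` B) = (P A * P B)%E.
Proof.
move=> dJK [a ma ->] [b mb ->]; rewrite !indepW//.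
have dKJ : {in K, forall i, i \notin J}.
  by move=> i; apply: contraL => /dJK.
pose c i := if i \in J then a i else b i.
have mc i : measurable (c i) by rewrite /c; case: ifP.
have -> : \bigcap_(i in [set i | i \in J]) (W i @^-1` a i) `&`
          \bigcap_(i in [set i | i \in K]) (W i @^-1` b i) =
          \bigcap_(i in [set i | i \in J :|: K]) (W i @^-1` c i).
  apply/seteqP; split=> [w [aw bw] i /=|w cw].
    rewrite inE /c; case: ifPn => iJ /=; first by move=> _; exact: aw.
    exact: bw.
  split=> i /= iJ; have /= := cw i; rewrite inE iJ ?orbT /= /c.
    by rewrite iJ; apply.
  by rewrite (negbTE (dKJ _ iJ)); apply.
rewrite indepW// (eq_bigl [predU J & K]); last by move=> i; rewrite !inE.
rewrite bigU/=.
  congr (_ * _)%E; apply: eq_bigr => i iJ; first by rewrite /c iJ.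
  by rewrite /c (negbTE (dKJ _ iJ)).
by rewrite disjoint_subset; apply/fintype.subsetP => i /dJK; rewrite inE.
Qed.

(** Two finite measures that agree on an intersection-stable generating family are equal. With one
    event fixed, this extends the product formula from cylinders to the generated sigma-algebra,
    first on the side of [J], then on that of [K]. *)
Lemma coarse_indep J K A B : {in J, forall i, i \notin K} ->
  measurable (A : set (coarse J)) -> measurable (B : set (coarse K)) ->
  P (A `&` B) = (P A * P B)%E.
Proof.
move=> dJK mA mB.
have ext (L : {set I}) (D : set T) : measurable D ->
    (forall C, cylinder L C -> P (C `&` D) = (P D * P C)%E) ->
    forall C, measurable (C : set (coarse L)) -> P (C `&` D) = (P D * P C)%E.
  move=> mD cD C mC; have finD := fin_num_measure P D mD.
  have fD0 : (0 <= fine (P D))%R by exact: fine_ge0.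
  have mE X : mscale (NngNum fD0) P X = (P D * P X)%E by rewrite /mscale/= fineK.
  rewrite -mE; apply: (@g_sigma_algebra_measure_unique _ R T (cylinder L)
    (@cylinder_measurable L) (fun=> setT) (fun=> cylinderT L) _
    (mrestr P mD) (mscale (NngNum fD0) P) (@cylinder_setI L)) => //.
  - by rewrite bigcup_const//; exists 0%N.
  - by move=> X cX; exact: (etrans (cD _ cX) (esym (mE X))).
  - move=> _; apply: (@le_lt_trans _ _ 1%E); last exact: ltry.
    by apply: (@probability_le1 _ _ _ P); exact: measurableI.
rewrite muleC; apply: (ext J) => // [|C cC]; first exact: coarse_measurable mB.
rewrite setIC muleC; apply: (ext K) => // [|D cD].
  exact: cylinder_measurable cC.
by rewrite setIC; exact: (cylinder_indep dJK cC cD).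
Qed.

Let measurable_to_coarse J : measurable_fun setT (id : T -> coarse J).
Proof. by move=> _ B mB; rewrite setTI; exact: coarse_measurable mB. Qed.

Lemma decoupling_measurable J K (f : coarse J * coarse K -> \bar R) :
  measurable_fun setT f -> (forall z, 0 <= f z)%E ->
  measurable_fun setT (fun w : T => \int[P]_w' f (w, w'))%E.
Proof.
move=> mf f0.
pose iK : {mfun T >-> coarse K} := HB.pack (id : T -> coarse K)
  (isMeasurableFun.Build _ _ _ _ _ (@measurable_to_coarse K)).
have mF := @measurable_fun_fubini_tonelli_F _ _ (coarse J) (coarse K) R
  (distribution P iK) f mf f0.
apply: (@measurable_coarse _ _ J).
apply: eq_measurable_fun mF => w _ /=.
rewrite /fubini_F ge0_integral_distribution//.
by apply: measurableT_comp => //; exact: measurable_pair1.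
Qed.

(** The identity of [T], seen as a map to [coarse J] and as a map to [coarse K], gives two
    independent random elements. The law of the diagonal map is therefore the product of their laws,
    and Tonelli's theorem splits the integral. *)
Lemma decoupling J K (f : coarse J * coarse K -> \bar R) : {in J, forall i, i \notin K} ->
  measurable_fun setT f -> (forall z, 0 <= f z)%E ->
  (\int[P]_w f (w, w) = \int[P]_w \int[P]_w' f (w, w'))%E.
Proof.
move=> dJK mf f0.
pose iJ : {mfun T >-> coarse J} := HB.pack (id : T -> coarse J)
  (isMeasurableFun.Build _ _ _ _ _ (@measurable_to_coarse J)).
pose iK : {mfun T >-> coarse K} := HB.pack (id : T -> coarse K)
  (isMeasurableFun.Build _ _ _ _ _ (@measurable_to_coarse K)).
have mdiag : measurable_fun setT (fun w => (iJ w, iK w)).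
  by apply: measurable_fun_pair; exact: measurable_funPT.
pose diag : {mfun T >-> (coarse J * coarse K)%type} :=
  HB.pack (fun w => (iJ w, iK w)) (isMeasurableFun.Build _ _ _ _ _ mdiag).
transitivity (\int[distribution P diag]_z f z)%E.
  by rewrite ge0_integral_distribution.
transitivity (\int[(distribution P iJ \x distribution P iK)%E]_z f z)%E.
  apply: eq_measure_integral => A mA _; apply/esym.
  apply: product_measure_unique => // {mA}A B mA mB.
  by rewrite /distribution /pushforward /=; exact: (coarse_indep dJK).
rewrite fubini_tonelli1//= ge0_integral_distribution//=.
- apply: eq_integral => w _ /=.
  rewrite /fubini_F ge0_integral_distribution//.
  by apply: measurableT_comp => //; exact: measurable_pair1.
- exact: measurable_fun_fubini_tonelli_F.
- by move=> w; exact: integral_ge0.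
Qed.

End Decoupling.

(** * Gaussian integrals and expectations *)

Section NormalIntegral.
Context {R : realType}.
Local Notation mu := (@lebesgue_measure R).
Implicit Types m s l x y : R.

(** The Radon-Nikodym derivative of the normal law and [normal_pdf] have equal integrals over every
    measurable set, hence agree almost everywhere. *)
Lemma ge0_integral_normal_prob m s (f : R -> \bar R) :
  measurable_fun setT f -> (forall x, 0 <= f x)%E ->
  (\int[normal_prob m s]_x f x = \int[mu]_x (f x * (normal_pdf m s x)%:E))%E.
Proof.
move=> mf f0; have dom := normal_prob_dominates m s.
rewrite -(Radon_Nikodym_SigmaFinite.change_of_variables dom)//.
have mrn : measurable_fun setT
    (Radon_Nikodym_SigmaFinite.f (normal_prob m s) mu : R -> \bar R).
  exact: measurable_int (Radon_Nikodym_SigmaFinite.f_integrable dom).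
have mpdf : measurable_fun setT (EFin \o normal_pdf m s).
  by apply/measurable_EFinP; exact: measurable_normal_pdf.
apply: ae_eq_integral => //; try exact: emeasurable_funM.
apply: ae_eqe_mul2l; apply: integral_ae_eq => //.
  exact: Radon_Nikodym_SigmaFinite.f_integrable.
by move=> E _ mE; rewrite -Radon_Nikodym_SigmaFinite.f_integral.
Qed.

(* Completing the square turns the integrand into a multiple of another normal
   density. *)
Lemma integral_normal_prob_expR_sqr s l x y : s != 0 ->
  2 * l * (y * s) ^+ 2 < 1 ->
  let k := 1 - 2 * l * (y * s) ^+ 2 in
  (\int[normal_prob 0 s]_z (expR (l * (x + y * z) ^+ 2))%:E =
   ((Num.sqrt k)^-1 * expR (l / k * x ^+ 2))%:E)%E.
Proof.
move=> s0 lys k; have k0 : 0 < k by rewrite subr_gt0.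
have sk0 : 0 < Num.sqrt k by rewrite sqrtr_gt0.
have kE : Num.sqrt k ^+ 2 = k by rewrite sqr_sqrtr// ltW.
have kn0 : k != 0 by rewrite gt_eqF.
have skn0 : Num.sqrt k != 0 by rewrite gt_eqF.
rewrite ge0_integral_normal_prob//; last first.
  apply/measurable_EFinP; apply: measurableT_comp => //.
  apply: measurable_funM => //; apply: measurable_funX.
  by apply: measurable_funD => //; exact: measurable_funM.
(* [s'] and [m'] are the standard deviation and the mean of the density that is left once the square
   is completed. *)
pose s' := s / Num.sqrt k.
have s'0 : s' != 0 by rewrite mulf_neq0// invr_eq0.
pose m' := 2 * l * x * y * s ^+ 2 / k.
transitivity (\int[mu]_z (((Num.sqrt k)^-1 * expR (l / k * x ^+ 2))%:E *
    (normal_pdf m' s' z)%:E))%E.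
  apply: eq_integral => z _; rewrite -!EFinM; congr (_%:E).
  rewrite !normal_pdfE// /normal_peak /normal_fun.
  have -> : Num.sqrt (s ^+ 2 * pi *+ 2) = Num.sqrt k * Num.sqrt (s' ^+ 2 * pi *+ 2).
    rewrite -sqrtrM ?ltW//; congr Num.sqrt; rewrite /s' exprMn exprVn kE.
    by field.
  rewrite invfM mulrCA -!mulrA; congr (_ * _); rewrite [RHS]mulrCA.
  congr (_ * _); rewrite -!expRD; congr expR.
  by rewrite /m' /s' exprMn exprVn kE subr0; rewrite /k in kn0 *; field; rewrite kn0 s0.
rewrite ge0_integralZl//.
- by rewrite integral_normal_pdf mule1.
- by apply/measurable_EFinP; exact: measurable_normal_pdf.
- by move=> z _; rewrite lee_fin normal_pdf_ge0.
Qed.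
End NormalIntegral.

Lemma measurable_bool_set d (T : measurableType d) (f : T -> bool) :
  measurable_fun setT f -> measurable [set w | f w].
Proof.
by move=> mf; rewrite -[X in measurable X]setTI; exact: (mf measurableT [set true]).
Qed.

(** * Calculus of expectations *)

Section Mean.
Context d (T : measurableType d) (R : realType) (P : probability T R).
Implicit Types (f g : T -> R) (x y c : R).

(** Integrability travels with the value, so that linearity and comparison need no separate
    integrability goals. *)
Definition mean f x : Prop :=
  P.-integrable setT (EFin \o f) /\ (\int[P]_w (f w)%:E = x%:E)%E.

Lemma mean_measurable f x : mean f x -> measurable_fun setT f.
Proof. by move=> [/measurable_int mf _]; exact/measurable_EFinP. Qed.

Lemma eq_mean f g x : f =1 g -> mean f x -> mean g x.
Proof. by move=> /funext ->. Qed.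

Lemma mean_unique f x y : mean f x -> mean f y -> x = y.
Proof. by move=> [_ fx] [_]; rewrite fx => -[]. Qed.

Lemma mean_ge0 f x : measurable_fun setT f -> (forall w, 0 <= f w) ->
  (\int[P]_w (f w)%:E = x%:E)%E -> mean f x.
Proof.
move=> mf f0 fx; split => //; apply/integrableP; split.
  exact/measurable_EFinP.
under eq_integral do rewrite /= ger0_norm//.
by rewrite fx ltry.
Qed.

Lemma mean_cst c : mean (fun=> c) c.
Proof.
split; last by rewrite integral_cst//=; rewrite probability_setT mule1.
exact: finite_measure_integrable_cst.
Qed.

Lemma meanD f g x y : mean f x -> mean g y -> mean (fun w => f w + g w) (x + y).
Proof.
move=> [fi fx] [gi gy]; split.
  by rewrite (_ : _ \o _ = (EFin \o f) \+ (EFin \o g))%E//; exact: integrableD.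
by rewrite integralD_EFin// fx gy.
Qed.

Lemma meanZ c f x : mean f x -> mean (fun w => c * f w) (c * x).
Proof.
move=> [fi fx]; split.
  by rewrite (_ : _ \o _ = (fun w => c%:E * (EFin \o f) w))%E//; exact: integrableZl.
by under eq_integral do rewrite EFinM; rewrite integralZl// fx.
Qed.

Lemma meanB f g x y : mean f x -> mean g y -> mean (fun w => f w - g w) (x - y).
Proof.
move=> fx gy; rewrite -[- y]mulN1r.
apply: (@eq_mean (fun w => f w + -1 * g w)); first by move=> w; rewrite mulN1r.
by apply: meanD => //; exact: meanZ.
Qed.

Lemma mean_sum (I : eqType) (s : seq I) (F : I -> T -> R) (x : I -> R) :
  (forall i, mean (F i) (x i)) ->
  mean (fun w => \sum_(i <- s) F i w) (\sum_(i <- s) x i).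
Proof.
move=> Fx; elim: s => [|i s IH].
  rewrite big_nil; apply: eq_mean (mean_cst 0) => w.
  by rewrite big_nil.
rewrite big_cons; apply: eq_mean (meanD (Fx i) IH) => w.
by rewrite big_cons.
Qed.

Lemma mean_le f g x y : mean f x -> mean g y -> (forall w, f w <= g w) -> x <= y.
Proof.
move=> [fi fx] [gi gy] fg; rewrite -lee_fin -fx -gy.
by apply: le_integral => // w _; rewrite lee_fin.
Qed.

Lemma mean_dom f g y : measurable_fun setT f -> (forall w, 0 <= f w) ->
  (forall w, f w <= g w) -> mean g y -> exists x, mean f x.
Proof.
move=> mf f0 fg [gi gy].
have fi : P.-integrable setT (EFin \o f).
  apply: le_integrable gi => //; first exact/measurable_EFinP.
  move=> w _ /=; rewrite !ger0_norm ?lee_fin//.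
  exact: le_trans (f0 w) (fg w).
exists (fine (\int[P]_w (f w)%:E)); split => //.
by rewrite fineK//; exact: integrable_fin_num.
Qed.

Lemma mean_indic (A : set T) : measurable A -> mean (\1_A : T -> R) (fine (P A)).
Proof.
move=> mA; apply: mean_ge0 => //.
by rewrite integral_indic// setIT fineK// fin_num_measure.
Qed.

Lemma mean_fin f x (A : set T) : measurable A -> mean f x ->
  (forall w, 0 <= f w) -> (forall w, A w -> 1 <= f w) -> (P A <= x%:E)%E.
Proof.
move=> mA fx f0 Af; rewrite -(fineK (fin_num_measure P A mA)) lee_fin.
apply: (mean_le (mean_indic mA) fx) => w.
by rewrite indicE; case: (boolP (w \in A)) => [/set_mem/Af|_].
Qed.

Lemma mean_markov f x c (A : set T) : measurable A -> mean f x ->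
  (forall w, 0 <= f w) -> 0 < c -> (forall w, A w -> c <= f w) ->
  (P A <= (x / c)%:E)%E.
Proof.
move=> mA fx f0 c0 Af; apply: (@mean_fin (fun w => c^-1 * f w)) => //.
- by rewrite mulrC; exact: meanZ.
- by move=> w; rewrite mulr_ge0// invr_ge0 ltW.
- by move=> w /Af; rewrite mulrC ler_pdivlMr// mul1r.
Qed.

End Mean.

Section IndependentMean.
Context d (T : measurableType d) (R : realType) (P : probability T R).
Context (I : finType) (W : I -> {RV P >-> R}).
Hypothesis indepW : mutually_independent W.
Implicit Types J K : {set I}.

(** Conditional expectation by freezing: the coordinates in [J] are held fixed while those in [K]
    are averaged, which gives [g]; then [g] is averaged. *)
Lemma mean_decoupling J K (f : coarse W J * coarse W K -> R) (g : T -> R) x :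
  {in J, forall i, i \notin K} -> measurable_fun setT f ->
  (forall z, 0 <= f z) -> (forall w, mean P (fun w' => f (w, w')) (g w)) ->
  mean P g x -> mean P (fun w => f (w, w)) x.
Proof.
move=> dJK mf f0 fg gx.
have mg : measurable_fun setT (EFin \o f) by exact/measurable_EFinP.
apply: mean_ge0 => //.
  apply: (measurableT_comp mf); apply: measurable_fun_pair.
    by apply: (@measurable_coarse _ _ _ _ _ W _ _ J); exact: measurable_id.
  by apply: (@measurable_coarse _ _ _ _ _ W _ _ K); exact: measurable_id.
rewrite (decoupling indepW dJK mg); last by move=> z; rewrite lee_fin.
by under eq_integral do rewrite /= (fg _).2; exact: gx.2.
Qed.

Lemma mean_indepM J K (f g : T -> R) x y :
  {in J, forall i, i \notin K} ->
  measurable_fun setT (f : coarse W J -> R) ->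
  measurable_fun setT (g : coarse W K -> R) ->
  (forall w, 0 <= f w) -> (forall w, 0 <= g w) ->
  mean P f x -> mean P g y -> mean P (fun w => f w * g w) (x * y).
Proof.
move=> dJK mf mg f0 g0 fx gy.
apply: (@mean_decoupling J K (fun z => f z.1 * g z.2) (fun w => f w * y)) => //.
- apply: measurable_funM.
    by apply: (measurableT_comp mf).
  by apply: (measurableT_comp mg).
- by move=> z; exact: mulr_ge0.
- by move=> w; exact: (meanZ (f w) gy).
- by rewrite mulrC; apply: eq_mean (meanZ y fx) => w; rewrite mulrC.
Qed.

End IndependentMean.

(** * Quadratic forms in independent Gaussian variables *)

Section GaussianForms.
Context d (T : measurableType d) (R : realType) (P : probability T R).
Context (I : finType) (W : I -> {RV P >-> R}) (sg : R).
Hypothesis indepW : mutually_independent W.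
Hypothesis sg0 : sg != 0.
Hypothesis gaussW : forall i (B : set R), measurable B ->
  distribution P (W i) B = normal_prob 0 sg B.
Implicit Types (l x y : R) (J K : {set I}).

Lemma measurable_linear_form (Q : finType) (h : Q -> I) (c : Q -> R)
    (s : seq Q) K : {in s, forall q, h q \in K} ->
  measurable_fun setT ((fun w => \sum_(q <- s) c q * W (h q) w) : coarse W K -> R).
Proof.
elim: s => [|q s IH] sK.
  by under eq_fun do rewrite big_nil; exact: measurable_cst.
under eq_fun do rewrite big_cons.
apply: measurable_funD.
  apply: measurable_funM => //; apply: measurable_coord.
  by apply: sK; rewrite mem_head.
by apply: IH => q' q's; apply: sK; rewrite in_cons q's orbT.
Qed.

Lemma mean_expR_sqr i l x y : 2 * l * (y * sg) ^+ 2 < 1 ->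
  let k := 1 - 2 * l * (y * sg) ^+ 2 in
  mean P (fun w => expR (l * (x + y * W i w) ^+ 2))
    ((Num.sqrt k)^-1 * expR (l / k * x ^+ 2)).
Proof.
move=> lys k.
have mf (U := measurableTypeR R) :
    measurable_fun setT (fun z : U => expR (l * (x + y * z) ^+ 2)).
  apply: measurableT_comp => //; apply: measurable_funM => //.
  by apply: measurable_funX; apply: measurable_funD => //; exact: measurable_funM.
have mW : measurable_fun setT (W i : T -> measurableTypeR R).
  by move=> _ B mB; exact: (@measurable_funP _ _ _ _ _ (W i)).
pose W' : {mfun T >-> measurableTypeR R} :=
  HB.pack (W i : T -> measurableTypeR R) (isMeasurableFun.Build _ _ _ _ _ mW).
apply: mean_ge0 => [|w|]; [exact: (measurableT_comp mf mW)|exact: expR_ge0|].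
rewrite -(integral_normal_prob_expR_sqr x sg0 lys).
transitivity (\int[distribution P W']_z (expR (l * (x + y * z) ^+ 2))%:E)%E.
  by rewrite ge0_integral_distribution//; exact/measurable_EFinP.
by apply: eq_measure_integral => B mB _; exact: gaussW.
Qed.

(** Induction on the list with a free offset [x]. Averaging over the tail turns [l] into [l / k],
    and the head is then a single Gaussian with that parameter. The normalizing factors combine
    because [k * (k' / k) = k']. *)
Lemma mean_expR_sqr_linear (Q : finType) (h : Q -> I) (c : Q -> R) (s : seq Q)
    l x : injective h -> uniq s ->
  let v := \sum_(q <- s) (c q * sg) ^+ 2 in 2 * l * v < 1 ->
  let k := 1 - 2 * l * v in
  mean P (fun w => expR (l * (x + \sum_(q <- s) c q * W (h q) w) ^+ 2))
    ((Num.sqrt k)^-1 * expR (l / k * x ^+ 2)).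
Proof.
move=> hI; elim: s x => [|q s IH] x.
  move=> _ v lv k; have -> : k = 1 by rewrite /k /v big_nil mulr0 subr0.
  rewrite sqrtr1 ?invr1 ?mulr1 ?mul1r.
  apply: eq_mean (mean_cst P (expR (l * x ^+ 2))) => w.
  by rewrite big_nil addr0.
move=> /= /andP[qs us]; set v := \sum_(_ <- s) _ in IH *.
rewrite big_cons -/v => lv.
have v0 : 0 <= v by apply: sumr_ge0 => ? _; exact: sqr_ge0.
set b := (c q * sg) ^+ 2 in lv *; have b0 : 0 <= b by exact: sqr_ge0.
have lv' : 2 * l * v < 1.
  (* For [l >= 0] dropping [b] only lowers the left side; for [l < 0] that side is nonpositive. *)
  by have [l0|l0] := leP 0 l; nra.
have {}IH y := IH y us lv'; move: IH; set k := 1 - 2 * l * v => IH.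
set k' := 1 - 2 * l * (b + v).
have k0 : 0 < k by rewrite subr_gt0.
have lk : 2 * (l / k) * b < 1.
  by rewrite mulrA mulrAC ltr_pdivrMr// mul1r ltrBrDr -mulrDr.
have k'0 : 0 < k' by rewrite subr_gt0.
have kE : 1 - 2 * (l / k) * b = k' / k.
  by rewrite /k' /k; field; rewrite gt_eqF.
have := mean_expR_sqr (h q) x lk; rewrite -/b kE => Hq.
apply: eq_mean => [w|]; first by rewrite big_cons addrA.
pose J : {set I} := [set h q]%SET; pose K : {set I} := [set h q' | q' in s]%SET.
apply: (@mean_decoupling _ _ _ _ _ W indepW J K (fun z => expR (l *
    (x + c q * W (h q) z.1 + \sum_(q' <- s) c q' * W (h q') z.2) ^+ 2))
    (fun w => (Num.sqrt k)^-1 * expR (l / k * (x + c q * W (h q) w) ^+ 2))).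
- move=> i; rewrite inE => /eqP ->; apply/imsetP => -[q' q's /hI qq'].
  by rewrite qq' q's in qs.
- apply: measurableT_comp => //; apply: measurable_funM => //.
  apply: measurable_funX; apply: measurable_funD.
    apply: measurable_funD => //; apply: measurable_funM => //.
    by apply: measurableT_comp => //; apply: measurable_coord; rewrite inE.
  apply: (measurableT_comp (measurable_linear_form (K := K) (s := s) _ _)) => //.
  by move=> q' q's; apply/imsetP; exists q'.
- by move=> z; exact: expR_ge0.
- by move=> w /=; exact: IH.
- have -> : (Num.sqrt k')^-1 * expR (l / k' * x ^+ 2) = (Num.sqrt k)^-1 *
    ((Num.sqrt (k' / k))^-1 * expR (l / k / (k' / k) * x ^+ 2)).
    have kk : k * (k' / k) = k' by field; rewrite gt_eqF.
    have lk' : l / k / (k' / k) = l / k' by rewrite invf_div mulrA divfK// gt_eqF.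
    rewrite lk' mulrA -invfM -sqrtrM ?ltW// kk.
    by [].
  exact: meanZ.
Qed.

(* The Laplace transform of a (rescaled) chi-square law with [#|A|] degrees of
   freedom. *)
Lemma mean_expR_quadratic (A Q : finType) (h : A -> Q -> I) (c : Q -> R) l :
  (forall a a' q q', h a q = h a' q' -> a = a' /\ q = q') ->
  let v := \sum_q (c q * sg) ^+ 2 in 2 * l * v < 1 ->
  mean P (fun w => expR (l * \sum_a (\sum_q c q * W (h a q) w) ^+ 2))
    ((Num.sqrt (1 - 2 * l * v))^-1 ^+ #|A|).
Proof.
move=> hI v lv.
suff H (s : seq A) : uniq s ->
    mean P (fun w => expR (l * \sum_(a <- s) (\sum_q c q * W (h a q) w) ^+ 2))
    ((Num.sqrt (1 - 2 * l * v))^-1 ^+ size s).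
  have := H _ (index_enum_uniq A); congr mean.
  by rewrite -[LHS]/(_ ^+ size _) cardE enumT.
elim: s => [_|a s IH /= /andP[as_ us]].
  rewrite expr0; apply: eq_mean (mean_cst P 1) => w.
  by rewrite big_nil mulr0 expR0.
apply: eq_mean => [w|]; first by rewrite big_cons mulrDr expRD.
pose J : {set I} := [set h a q | q : Q]%SET.
pose K : {set I} := [set h a' q | a' in s, q in Q]%SET.
rewrite exprS; apply: (mean_indepM indepW (J := J) (K := K)).
- move=> _ /imsetP[q _ ->]; apply/imset2P => -[a' q' a's _ /hI[aa' _]].
  by rewrite aa' a's in as_.
- apply: measurableT_comp => //; apply: measurable_funM => //.
  apply: measurable_funX; apply: measurable_linear_form => q _.
  by apply/imsetP; exists q.
- apply: measurableT_comp => //; apply: measurable_funM => //.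
  (* Replacing the summand by 0 outside [s] makes the membership [a' \in s] available when
     measurability is checked term by term. *)
  rewrite [X in measurable_fun _ X](_ : _ = (fun w => \sum_(a' <- s)
    if a' \in s then (\sum_q c q * W (h a' q) w) ^+ 2 else 0)); last first.
    by apply/funext => w; rewrite big_seq [RHS]big_seq; apply: eq_bigr => i ->.
  apply: measurable_sum => a'; case a's : (a' \in s) => //.
  apply: measurable_funX; apply: measurable_linear_form => q _.
  by apply/imset2P; exists a' q.
- by move=> w; exact: expR_ge0.
- by move=> w; exact: expR_ge0.
- have ha : injective (h a) by move=> q q' /hI[].
  have := mean_expR_sqr_linear (h := h a) (c := c) 0 ha (index_enum_uniq Q) lv.
  rewrite expr0n/= mulr0 expR0 mulr1; apply: eq_mean => w.
  by rewrite add0r.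
- exact: IH.
Qed.

End GaussianForms.

(** * Moments from the Laplace transform *)

Section MomentsOfGamma.
Context d (T : measurableType d) (R : realType) (P : probability T R).
Implicit Types (S : T -> R) (l h nu : R).

(** The function [f t - t * m] has a local minimum at [x], so its derivative [D - m] vanishes
    there. *)
Lemma is_derive_tangent (f : R -> R) (x D m e : R) : 0 < e ->
  (forall t, `|t - x| < e -> derivable f t 1) -> is_derive x 1 f D ->
  (forall t, `|t - x| < e -> f x + (t - x) * m <= f t) -> m = D.
Proof.
move=> e0 fd fD ftan.
pose g t := f t - t * m.
have gD : is_derive x 1 g (D - m).
  by apply: is_derive_eq; rewrite scaler0 add0r scaler1.
have g0 : is_derive x 1 g 0.
  apply: (@derive1_at_min _ g (x - e) (x + e)); first by lra.
  - move=> t; rewrite in_itv/= => /andP[t1 t2].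
    have te : `|t - x| < e by rewrite ltr_norml; apply/andP; split; lra.
    by apply: derivableB; [exact: fd|exact: derivableM].
  - by rewrite in_itv/=; apply/andP; split; lra.
  - move=> t; rewrite in_itv/= => /andP[t1 t2].
    have te : `|t - x| < e by rewrite ltr_norml; apply/andP; split; lra.
    by have := ftan t te; rewrite /g; lra.
by have := @derive_val _ _ _ _ _ _ _ gD; rewrite (@derive_val _ _ _ _ _ _ _ g0); lra.
Qed.

Lemma is_derive_affine_powR (c a l : R) : 0 < 1 - 2 * l ->
  is_derive l 1 (fun t => c * (1 - 2 * t) `^ a)
    (c * (- (2 * a) * (1 - 2 * l) `^ (a - 1))).
Proof.
move=> l0.
have H : is_derive l 1 (fun t => (1 - 2 * t) `^ a)
    ((a * (1 - 2 * l) `^ (a - 1)) * (- 2)).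
  have H1 : is_derive l (1 : R) (fun t : R => 1 - 2 * t) (- 2).
    by apply: is_derive_eq; rewrite /GRing.scale/=; ring.
  have H2 := is_derive1_powR a l0.
  exact: (is_derive1_comp (f := fun u => u `^ a)).
by apply: is_derive_eq; rewrite /GRing.scale/=; ring.
Qed.

(** Induction on [k] without differentiating under the integral. Convexity of the exponential gives
    a pointwise tangent inequality; taking means, the unknown mean for [k.+1] is the slope of a line
    supporting the transform for [k] at [l], hence its derivative. *)
Lemma mean_expM_expR S nu k l : measurable_fun setT S -> (forall w, 0 <= S w) ->
  (forall l', 2 * l' < 1 ->
    mean P (fun w => expR (l' * S w)) ((1 - 2 * l') `^ (- (nu / 2)))) ->
  2 * l < 1 ->
  mean P (fun w => S w ^+ k * expR (l * S w))
    (\prod_(i < k) (nu + 2 * i%:R) * (1 - 2 * l) `^ (- (nu / 2 + k%:R))).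
Proof.
move=> mS S0 mgf.
elim: k l => [|k IH] l l1.
  rewrite big_ord0 addr0 mul1r; apply: eq_mean (mgf l l1) => w.
  by rewrite expr0 mul1r.
have mSe j l' : measurable_fun setT (fun w => S w ^+ j * expR (l' * S w)).
  apply: measurable_funM; first exact: measurable_funX.
  by apply: measurableT_comp => //; exact: measurable_funM.
have tangent t w : S w ^+ k * expR (l * S w) +
    (t - l) * (S w ^+ k.+1 * expR (l * S w)) <= S w ^+ k * expR (t * S w).
  have -> : expR (t * S w) = expR (l * S w) * expR ((t - l) * S w).
    by rewrite -expRD -mulrDl addrCA subrr addr0.
  have -> : S w ^+ k * expR (l * S w) + (t - l) * (S w ^+ k.+1 * expR (l * S w)) =
    S w ^+ k * (expR (l * S w) * (1 + (t - l) * S w)) by rewrite exprS; ring.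
  rewrite ler_wpM2l ?exprn_ge0// ler_wpM2l ?expR_ge0//.
  exact: expR_ge1Dx.
(* Within distance [e] of [l] the condition [2 * t < 1] persists. *)
pose e : R := (1 - 2 * l) / 2.
have e0 : 0 < e by rewrite /e; lra.
have te t : `|t - l| < e -> 2 * t < 1 by rewrite ltr_norml /e => /andP[]; lra.
(* Integrability of the next power: the tangent inequality at a point [t > l] dominates it by a
   multiple of an integrand already known to have a mean. *)
have [m Hm] : exists m, mean P (fun w => S w ^+ k.+1 * expR (l * S w)) m.
  pose t := l + e / 2.
  have t1 : 2 * t < 1 by rewrite /t /e; lra.
  apply: (@mean_dom _ _ _ _ _ (fun w => (t - l)^-1 * (S w ^+ k * expR (t * S w)))
    ((t - l)^-1 * _)) => //.
  - by move=> w; rewrite mulr_ge0 ?exprn_ge0 ?expR_ge0.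
  - move=> w; rewrite ler_pdivlMl; last by rewrite /t; lra.
    have := tangent t w.
    have : 0 <= S w ^+ k * expR (l * S w) by rewrite mulr_ge0 ?exprn_ge0 ?expR_ge0.
    by lra.
  - exact: meanZ (IH t t1).
suff -> : \prod_(i < k.+1) (nu + 2 * i%:R) *
    (1 - 2 * l) `^ (- (nu / 2 + k.+1%:R)) = m by [].
apply/esym.
pose c : R := \prod_(i < k) (nu + 2 * i%:R).
have Df (t : R) : 2 * t < 1 -> is_derive t (1 : R)
    (fun t => c * (1 - 2 * t) `^ (- (nu / 2 + k%:R)))
    (\prod_(i < k.+1) (nu + 2 * i%:R) * (1 - 2 * t) `^ (- (nu / 2 + k.+1%:R))).
  move=> t1; have t0 : 0 < 1 - 2 * t by lra.
  have := is_derive_affine_powR c (- (nu / 2 + k%:R)) t0.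
  congr (is_derive _ _ _ _); rewrite big_ord_recr/= -/c -mulrA; congr (_ * (_ * _)).
    by field.
  by congr (_ `^ _); rewrite -natr1; ring.
apply: (is_derive_tangent e0 _ (Df l l1)).
  by move=> t /te /Df.
move=> t /te t1.
exact: (mean_le (meanD (IH l l1) (meanZ (t - l) Hm)) (IH t t1) (tangent t)).
Qed.

Lemma mean_expM S nu k : measurable_fun setT S -> (forall w, 0 <= S w) ->
  (forall l, 2 * l < 1 ->
    mean P (fun w => expR (l * S w)) ((1 - 2 * l) `^ (- (nu / 2)))) ->
  mean P (fun w => S w ^+ k) (\prod_(i < k) (nu + 2 * i%:R)).
Proof.
move=> mS S0 mgf; have /(mean_expM_expR k mS S0 mgf) : 2 * (0 : R) < 1 by lra.
rewrite mulr0 subr0 powR1 mulr1; apply: eq_mean => w.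
by rewrite mul0r expR0 mulr1.
Qed.

End MomentsOfGamma.

(** * Polynomial bounds for real powers *)

Section PowerPolynomialBounds.
Context {R : realType}.
Implicit Types (f g : R -> R) (a s t u : R).

Lemma is_derive_continuous_within f g a b : 0 < a ->
  (forall t, 0 < t -> is_derive t 1 f (g t)) ->
  {within `[a, b], continuous f}.
Proof.
move=> a0 fg; apply: derivable_within_continuous => t.
by rewrite in_itv/= => /andP[at_ _]; have /fg := lt_le_trans a0 at_.
Qed.

(** By the mean value theorem [f] decreases up to 1 and increases after it, so its value 0 at 1 is a
    minimum. *)
Lemma ge0_derive_sign f g a u : 0 < a -> a <= 1 ->
  (forall t, 0 < t -> is_derive t 1 f (g t)) -> f 1 = 0 ->
  (forall t, a <= t -> 0 <= (t - 1) * g t) -> a <= u -> 0 <= f u.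
Proof.
move=> a0 a1 fg f1 gs au; have u0 := lt_le_trans a0 au.
have [u1|u1|->] := ltgtP u 1; last by rewrite f1.
- have [t|t] := @MVT _ f g _ _ u1 _ (is_derive_continuous_within u0 fg).
    by rewrite in_itv/= => /andP[ut _]; apply: fg; exact: lt_trans ut.
  rewrite in_itv/= f1 => /andP[ut t1] fE.
  have := gs t (ltW (le_lt_trans au ut)).
  by rewrite nmulr_rge0 ?subr_lt0// => gt; nra.
- have [t|t] := @MVT _ f g _ _ u1 _ (is_derive_continuous_within ltr01 fg).
    by rewrite in_itv/= => /andP[ut _]; apply: fg; exact: lt_trans ut.
  rewrite in_itv/= f1 => /andP[t1 tu] fE.
  have := gs t (le_trans a1 (ltW t1)).
  by rewrite pmulr_rge0 ?subr_gt0// => gt; nra.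
Qed.

(** A nondecreasing function that vanishes at 1 has the sign of [u - 1]. Applied to a derivative and
    followed by [ge0_derive_sign], this turns nonnegativity of a second derivative into
    nonnegativity of the function. *)
Lemma ge0_derive_monotone f g a u : 0 < a -> a <= 1 ->
  (forall t, 0 < t -> is_derive t 1 f (g t)) -> f 1 = 0 ->
  (forall t, a <= t -> 0 <= g t) -> a <= u -> 0 <= (u - 1) * f u.
Proof.
move=> a0 a1 fg f1 gs au; have u0 := lt_le_trans a0 au.
have [u1|u1|->] := ltgtP u 1; last by rewrite f1 mulr0.
- have [t|t] := @MVT _ f g _ _ u1 _ (is_derive_continuous_within u0 fg).
    by rewrite in_itv/= => /andP[ut _]; apply: fg; exact: lt_trans ut.
  rewrite in_itv/= f1 => /andP[ut t1] fE.
  have gt0 := gs t (ltW (le_lt_trans au ut)).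
  have -> : f u = g t * (u - 1) by lra.
  by rewrite mulrCA mulr_ge0// -expr2 sqr_ge0.
- have [t|t] := @MVT _ f g _ _ u1 _ (is_derive_continuous_within ltr01 fg).
    by rewrite in_itv/= => /andP[ut _]; apply: fg; exact: lt_trans ut.
  rewrite in_itv/= f1 => /andP[t1 tu] fE.
  have gt0 := gs t (le_trans a1 (ltW t1)).
  have -> : f u = g t * (u - 1) by lra.
  by rewrite mulrCA mulr_ge0// -expr2 sqr_ge0.
Qed.

(** The power is the exponential of [a * ln u], and [ln u <= u - 1] is reversed by the sign of
    [a]. *)
Lemma powR_bernoulli_le0 a u : a <= 0 -> 0 < u -> 1 + a * (u - 1) <= u `^ a.
Proof.
move=> a0 u0; rewrite /powR gt_eqF//; apply: le_trans (expR_ge1Dx _).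
rewrite lerD2l ler_wnM2l//.
by have := @le_ln1Dx _ (u - 1); rewrite addrCA subrr addr0; apply; lra.
Qed.

Lemma powR_bernoulli_itv01 a u : 0 <= a <= 1 -> 0 < u -> u `^ a <= 1 + a * (u - 1).
Proof.
move=> /andP[a0 a1] u0; rewrite -subr_ge0; set b := Num.min u 1.
have b0 : 0 < b by rewrite lt_min u0 ltr01.
have b1 : b <= 1 by rewrite ge_min lexx orbT.
have bu : b <= u by rewrite ge_min lexx.
apply: (@ge0_derive_sign (fun t => 1 + a * (t - 1) - t `^ a)
  (fun t => a * (1 - t `^ (a - 1))) b u b0 b1 _ _ _ bu).
- move=> t t0; have := is_derive1_powR a t0 => ?.
  by apply: is_derive_eq; rewrite /GRing.scale/=; ring.
- by rewrite powR1; ring.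
- move=> t bt; rewrite mulrCA mulr_ge0//.
  apply: (@ge0_derive_monotone (fun t => 1 - t `^ (a - 1))
    (fun t => (1 - a) * t `^ (a - 1 - 1)) b t b0 b1 _ _ _ bt).
  + move=> t' t'0; have := is_derive1_powR (a - 1) t'0 => ?.
    by apply: is_derive_eq; rewrite /GRing.scale/=; ring.
  + by rewrite powR1; ring.
  + by move=> t' _; rewrite mulr_ge0 ?powR_ge0// subr_ge0.
Qed.

(** The Taylor polynomial of degree 3 at 1 of the power of [u] with exponent [s]. *)
Definition cubic s u :=
  1 + s * (u - 1) - s * (1 - s) / 2 * (u - 1) ^+ 2
  + s * (1 - s) * (2 - s) / 6 * (u - 1) ^+ 3.

(** The degree 2 Taylor polynomial at 1 of the power with exponent [s - 1], minus that power. Up to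
    the factor [s] it is the derivative of the error of [cubic]. *)
Let quad s u := 1 - (1 - s) * (u - 1) + (1 - s) * (2 - s) / 2 * (u - 1) ^+ 2 - u `^ (s - 1).

Let is_derive_cubic s u : 0 < u ->
  is_derive u 1 (fun t => cubic s t - t `^ s) (s * quad s u).
Proof.
move=> u0; rewrite /cubic; have := is_derive1_powR s u0 => ?; apply: is_derive_eq.
by rewrite /quad /GRing.scale/=; field.
Qed.

Let is_derive_quad s u : 0 < u ->
  is_derive u 1 (quad s) ((s - 1) * (1 + (s - 2) * (u - 1) - u `^ (s - 2))).
Proof.
move=> u0; rewrite /quad; have := is_derive1_powR (s - 1) u0 => ?; apply: is_derive_eq.
have -> : s - 1 - 1 = s - 2 by ring.
by rewrite /GRing.scale/=; field.
Qed.

Let quad1 s : quad s 1 = 0.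
Proof. by rewrite /quad powR1; ring. Qed.

(** The derivative of [quad] is nonnegative by Bernoulli's inequality with the exponent
    [s - 2 <= 0], as [s - 1 <= 0]; two integrations from 1 conclude. *)
Lemma powR_le_cubic s u : 0 <= s <= 1 -> 0 <= u -> u `^ s <= cubic s u.
Proof.
move=> /andP[s0 s1]; rewrite le_eqVlt => /predU1P[<-|u0].
  (* At [u = 0] the power is 1 for [s = 0] and 0 otherwise. *)
  have [->|sn0] := eqVneq s 0; first by rewrite powRr0 /cubic; lra.
  rewrite powR0// (_ : cubic s 0 = (1 - s) * (2 - s) * (3 - s) / 6).
    by rewrite divr_ge0// !mulr_ge0//; lra.
  by rewrite /cubic; field.
rewrite -subr_ge0; set a := Num.min u 1.
have a0 : 0 < a by rewrite lt_min u0 ltr01.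
have a1 : a <= 1 by rewrite ge_min lexx orbT.
have au : a <= u by rewrite ge_min lexx.
apply: (@ge0_derive_sign (fun t => cubic s t - t `^ s) (fun t => s * quad s t) a u a0 a1 _ _ _ au).
- by move=> t; exact: is_derive_cubic.
- by rewrite /cubic powR1; ring.
- move=> t at_; rewrite mulrCA mulr_ge0//.
  apply: (@ge0_derive_monotone (quad s) _ a t a0 a1 (@is_derive_quad s) (quad1 s) _ at_).
  move=> t' at'; have t'0 := lt_le_trans a0 at'.
  have sn : s - 2 <= 0 by lra.
  have := powR_bernoulli_le0 sn t'0; nra.
Qed.

(** Below [2^-1] the sixth power term is at least 1 and [cubic] at most 1, so the left side is
    nonpositive. From [2^-1] on, the fourth power term alone suffices: its contribution
    [12 * (t - 1) ^+ 2] at the second derivative exceeds the Taylor error, which is at most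
    [8 * (t - 1) ^+ 2]. *)
Lemma powR_ge_cubic s u : 0 <= s <= 1 -> 0 <= u ->
  cubic s u - s * (u - 1) ^+ 4 - 64 * (u - 1) ^+ 6 <= u `^ s.
Proof.
move=> /andP[s0 s1] u0; have [u2|u2] := leP (2^-1) u; last first.
  apply: le_trans (powR_ge0 _ _).
  have D6 : 1 <= 64 * (u - 1) ^+ 6.
    have : 4^-1 <= (u - 1) ^+ 2 by nra.
    rewrite (_ : 6 = 2 * 3)%N// exprM; set x := _ ^+ 2 => x4.
    have : 16^-1 <= x ^+ 2 by nra.
    by rewrite (exprS x 2); nra.
  have D4 : 0 <= s * (u - 1) ^+ 4 by rewrite mulr_ge0// exprn_even_ge0.
  have c1 : cubic s u <= 1.
    have D1 : u - 1 <= 0 by lra.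
    have D3 : (u - 1) ^+ 3 <= 0 by rewrite exprS mulr_le0_ge0// sqr_ge0.
    have : s * (u - 1) <= 0 by rewrite mulr_ge0_le0.
    have : 0 <= s * (1 - s) / 2 * (u - 1) ^+ 2.
      by apply: mulr_ge0; [rewrite divr_ge0// mulr_ge0//; lra|exact: sqr_ge0].
    have : s * (1 - s) * (2 - s) / 6 * (u - 1) ^+ 3 <= 0.
      by apply: mulr_ge0_le0 => //; rewrite divr_ge0// !mulr_ge0//; lra.
    by rewrite /cubic; lra.
  by lra.
have h0 : 0 < 2^-1 :> R by lra.
have h1 : 2^-1 <= 1 :> R by lra.
have H : 0 <= u `^ s - cubic s u + s * (u - 1) ^+ 4; last first.
  have : 0 <= (u - 1) ^+ 6 by rewrite exprn_even_ge0.
  by lra.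
apply: (@ge0_derive_sign (fun t => t `^ s - cubic s t + s * (t - 1) ^+ 4)
  (fun t => s * (4 * (t - 1) ^+ 3 - quad s t)) 2^-1 u h0 h1 _ _ _ u2).
- move=> t t0; have cd := is_derive_cubic s t0.
  rewrite (_ : (fun t => _) = (fun t => - (cubic s t - t `^ s) + s * (t - 1) ^+ 4)).
    apply: is_derive_eq; rewrite /GRing.scale/=; ring.
  by apply/funext => x; ring.
- by rewrite /cubic powR1; ring.
move=> t t2; rewrite mulrCA mulr_ge0//.
apply: (@ge0_derive_monotone (fun t => 4 * (t - 1) ^+ 3 - quad s t)
  (fun t => 12 * (t - 1) ^+ 2 - (s - 1) * (1 + (s - 2) * (t - 1) - t `^ (s - 2)))
  2^-1 t h0 h1 _ _ _ t2).
- move=> t' t'0; have qd := is_derive_quad s t'0.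
  by apply: is_derive_eq; rewrite /GRing.scale/=; ring.
- by rewrite quad1; ring.
move=> {t2} {}t t2; have t0 : 0 < t by apply: lt_le_trans t2; lra.
have tn0 : t != 0 by rewrite gt_eqF.
have tI : t^-1 <= 2 by rewrite -[2]invrK lef_pV2 ?posrE//; lra.
have tI0 : 0 < t^-1 by rewrite invr_gt0.
(* The exponent splits as -1 and [- (1 - s)], and Bernoulli's inequality is applied to [t^-1] with
   the exponent [1 - s]. *)
have H : t `^ (s - 2) <= s * t^-1 + (1 - s) * t^-1 ^+ 2.
  have -> : s - 2 = - 1 + - (1 - s) by ring.
  rewrite powRD; last by rewrite tn0 implybT.
  have -> : t `^ (- (1 - s)) = t^-1 `^ (1 - s).
    by rewrite -(powR_inv1 (ltW t0)) -powRrM mulN1r.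
  rewrite (powR_inv1 (ltW t0)).
  have H1 : 0 <= 1 - s <= 1 by apply/andP; split; lra.
  apply: le_trans (ler_wpM2l (ltW tI0) (powR_bernoulli_itv01 H1 tI0)) _.
  by rewrite le_eqVlt; apply/orP; left; apply/eqP; ring.
(* First order expansions of [t^-1] and of its square at 1 with exact remainders, so that the affine
   part cancels in [pE]. *)
have E1 : t^-1 = 1 - (t - 1) + (t - 1) ^+ 2 * t^-1 by field.
have E2 : t^-1 ^+ 2 = 1 - 2 * (t - 1) + (t - 1) ^+ 2 * (t^-1 ^+ 2 + 2 * t^-1) by field.
set e := t^-1 in tI tI0 H E1 E2 *; set D2 := (t - 1) ^+ 2 in E1 E2 *.
have D20 : 0 <= D2 by exact: sqr_ge0.
have e8 : s * e + (1 - s) * (e ^+ 2 + 2 * e) <= 8 by nra.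
have pE : t `^ (s - 2) - (1 + (s - 2) * (t - 1)) <= 8 * D2.
  apply: (@le_trans _ _ (D2 * (s * e + (1 - s) * (e ^+ 2 + 2 * e)))); last by nra.
  have -> : D2 * (s * e + (1 - s) * (e ^+ 2 + 2 * e)) =
      s * (D2 * e) + (1 - s) * (D2 * (e ^+ 2 + 2 * e)) by ring.
  have -> : D2 * e = e - (1 - (t - 1)) by lra.
  have -> : D2 * (e ^+ 2 + 2 * e) = e ^+ 2 - (1 - 2 * (t - 1)) by lra.
  by lra.
have s10 : 0 <= 1 - s by lra.
have := ler_wpM2l s10 pE.
have : (1 - s) * (8 * D2) <= 1 * (8 * D2) by apply: ler_wpM2r; [exact: mulr_ge0|lra].
by lra.
Qed.

End PowerPolynomialBounds.

(** * Fractional moments of a normalized chi-square variable *)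

Section ChiSquarePowers.
Context d (T : measurableType d) (R : realType) (P : probability T R).
Implicit Types (u : T -> R) (nu s : R).

Lemma mean_poly u (m : nat -> R) (c : seq R) :
  (forall k, mean P (fun w => u w ^+ k) (m k)) ->
  mean P (fun w => \sum_(i < size c) c`_i * u w ^+ i)
    (\sum_(i < size c) c`_i * m i).
Proof. by move=> um; apply: mean_sum => i; exact: meanZ. Qed.

Lemma mean_chi_square_centered u nu : 0 < nu ->
  (forall k, mean P (fun w => u w ^+ k)
    (\prod_(i < k) (nu + 2 * i%:R) / nu ^+ k)) ->
  [/\ mean P (fun w => u w - 1) 0,
      mean P (fun w => (u w - 1) ^+ 2) (2 / nu),
      mean P (fun w => (u w - 1) ^+ 3) (8 / nu ^+ 2),
      mean P (fun w => (u w - 1) ^+ 4) (12 / nu ^+ 2 + 48 / nu ^+ 3) &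
      mean P (fun w => (u w - 1) ^+ 6)
        (120 / nu ^+ 3 + 2080 / nu ^+ 4 + 3840 / nu ^+ 5)].
Proof.
move=> nu0 um; have nu1 : nu != 0 by rewrite gt_eqF.
have H c := mean_poly c um.
have congr_mean f g x y : mean P f x -> f =1 g -> x = y -> mean P g y.
  by move=> fx fg <-; exact: eq_mean fx.
split.
(* Each list holds the coefficients of a power of [u - 1], constant term first. *)
- apply: congr_mean (H [:: -1; 1]) _ _ => [w|];
    by rewrite /= !big_ord_recl !big_ord0/= /bump /=; field.
- apply: congr_mean (H [:: 1; - 2; 1]) _ _ => [w|];
    by rewrite /= !big_ord_recl !big_ord0/= /bump /=; field.
- apply: congr_mean (H [:: -1; 3; - 3; 1]) _ _ => [w|];
    by rewrite /= !big_ord_recl !big_ord0/= /bump /=; field.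
- apply: congr_mean (H [:: 1; - 4; 6; - 4; 1]) _ _ => [w|];
    by rewrite /= !big_ord_recl !big_ord0/= /bump /=; field.
- apply: congr_mean (H [:: 1; - 6; 15; - 20; 15; - 6; 1]) _ _ => [w|];
    by rewrite /= !big_ord_recl !big_ord0/= /bump /=; field.
Qed.

Lemma mean_chi_square_powR u nu s : 1 <= nu -> measurable_fun setT u ->
  (forall w, 0 <= u w) ->
  (forall k, mean P (fun w => u w ^+ k)
    (\prod_(i < k) (nu + 2 * i%:R) / nu ^+ k)) ->
  0 <= s <= 1 ->
  exists2 x, mean P (fun w => u w `^ s) x &
    1 - s * (1 - s) / nu - 60 * s / nu ^+ 2 - 64 * (80 ^+ 2 / nu ^+ 3) <= x
    <= 1 - s * (1 - s) / nu + 3 * s / nu ^+ 2.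
Proof.
move=> nu1 mu u0 um s01; have /andP[s0 s1] := s01.
have nu0 : 0 < nu by exact: lt_le_trans nu1.
have [m1 m2 m3 m4 m6] := mean_chi_square_centered nu0 um.
have Hc : mean P (fun w => cubic s (u w))
    (1 + s * 0 - s * (1 - s) / 2 * (2 / nu) + s * (1 - s) * (2 - s) / 6 * (8 / nu ^+ 2)).
  exact: meanD (meanB (meanD (mean_cst P 1) (meanZ s m1)) (meanZ _ m2)) (meanZ _ m3).
have [x Hx] : exists x, mean P (fun w => u w `^ s) x.
  apply: mean_dom Hc => [|w|w].
  - by apply: (measurableT_comp (measurable_powR _)).
  - exact: powR_ge0.
  - exact: powR_le_cubic.
exists x => //.
set y := nu^-1; have y0 : 0 < y by rewrite invr_gt0.
have y1 : y <= 1 by rewrite invf_le1.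
rewrite -!exprVn -/y; apply/andP; split; last first.
  have := mean_le Hx Hc (fun w => powR_le_cubic s01 (u0 w)).
  rewrite -!exprVn -/y => /le_trans; apply.
  have sy : 0 <= s * y ^+ 2 by apply: mulr_ge0 => //; exact: sqr_ge0.
  have h : (1 - s) * (2 - s) <= 2 by nra.
  by have := ler_wpM2l sy h; lra.
have := mean_le (meanB (meanB Hc (meanZ s m4)) (meanZ 64 m6)) Hx
  (fun w => powR_ge_cubic s01 (u0 w)).
apply: le_trans; rewrite -!exprVn -/y.
have y2 : 0 <= y ^+ 2 by exact: sqr_ge0.
have y3 : 0 <= y ^+ 3 by rewrite exprn_ge0// ltW.
have y32 : y ^+ 3 <= y ^+ 2 by rewrite exprS ler_piMl.
have y43 : y ^+ 4 <= y ^+ 3 by rewrite exprS ler_piMl.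
have y53 : y ^+ 5 <= y ^+ 3 by apply: le_trans y43; rewrite exprS ler_piMl// exprn_ge0// ltW.
have h1 : 0 <= s * (1 - s) * (2 - s) / 6 * (8 * y ^+ 2).
  by apply: mulr_ge0; [rewrite divr_ge0// !mulr_ge0//; lra|lra].
have h2 : s * (12 * y ^+ 2 + 48 * y ^+ 3) <= s * (60 * y ^+ 2).
  by apply: ler_wpM2l => //; lra.
by lra.
Qed.

End ChiSquarePowers.

Section ExponentialBounds.
Context {R : realType}.
Implicit Types x y s : R.

(** The inverse of [1 - x] is [1 + x / (1 - x)], at most the exponential of [x / (1 - x)], which is
    at most [x + 2 * x ^+ 2] because [1 - x >= 2^-1]. *)
Lemma expR_le_1B x : x <= 2^-1 -> expR (- (x + 2 * x ^+ 2)) <= 1 - x.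
Proof.
move=> x2; have x1 : 0 < 1 - x by lra.
have x1n : 1 - x != 0 by rewrite gt_eqF.
rewrite expRN -[leRHS]invrK lef_pV2 ?posrE ?expR_gt0 ?invr_gt0//.
have -> : (1 - x)^-1 = 1 + x / (1 - x) by field.
apply: (le_trans (expR_ge1Dx _)); rewrite ler_expR.
have -> : x / (1 - x) = x + x ^+ 2 * (1 - x)^-1 by field.
rewrite lerD2l mulrC; apply: ler_wpM2r; first exact: sqr_ge0.
by rewrite -[2]invrK lef_pV2 ?posrE//; lra.
Qed.

Lemma powR_expR x y : 0 < x -> x `^ y = expR (y * ln x).
Proof. by move=> x0; rewrite /powR gt_eqF. Qed.

Lemma powR_1B_le x y : 0 <= y -> x <= 2^-1 ->
  (1 - x) `^ (- y) <= expR (y * (x + 2 * x ^+ 2)).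
Proof.
move=> y0 x2; have x1 : 0 < 1 - x by lra.
rewrite powR_expR// ler_expR mulNr -mulrN ler_wpM2l// lerNl.
by rewrite -[leLHS]expRK ler_ln ?posrE ?expR_gt0//; exact: expR_le_1B.
Qed.

(** Here [y] stands for [nu^-1]. The right side is [1 - x], and [expR_le_1B] costs an extra
    [2 * x ^+ 2 <= 5 * s * y ^+ 2 + 2 * z]; hence 65 in place of 60, and 192 = 3 * 64 in place of
    64. *)
Lemma chi_square_power_lower_bound s y : 0 <= s <= 1 -> 0 <= y -> y * 10 ^+ 3 <= 1 ->
  expR ((s ^+ 2 - s) * y - 65 * s * y ^+ 2 - 192 * (80 ^+ 2 * y ^+ 3)) <=
  1 - s * (1 - s) * y - 60 * s * y ^+ 2 - 64 * (80 ^+ 2 * y ^+ 3).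
Proof.
move=> /andP[s0 s1] y0 y3; set z := 64 * (80 ^+ 2 * y ^+ 3).
pose x := s * (1 - s) * y + 60 * s * y ^+ 2 + z.
have z0 : 0 <= z by rewrite !mulr_ge0// exprn_ge0.
have y2 : 0 <= y ^+ 2 by exact: sqr_ge0.
have y1 : y <= 1 / 1000 by lra.
have yy : y ^+ 2 <= y / 1000 by rewrite expr2; nra.
have zy : z <= y * 41 / 100.
  have : y ^+ 3 <= y / 1000 / 1000 by rewrite exprS; nra.
  by rewrite /z; lra.
have ss : 0 <= s * (1 - s) by nra.
have ss1 : s * (1 - s) <= s by nra.
have sy0 : 0 <= s * y by rewrite mulr_ge0.
have sy2 : s * y ^+ 2 <= s * y / 1000 by have := ler_wpM2l s0 yy; lra.
have sy20 : 0 <= s * y ^+ 2 by rewrite mulr_ge0.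
have ssy : 0 <= s * (1 - s) * y by exact: mulr_ge0.
have x0 : 0 <= x by rewrite /x; lra.
have xs : x <= 106 / 100 * (s * y) + z.
  have := ler_wpM2r y0 ss1; rewrite /x; lra.
have xy : x <= 2 * y.
  have : s * y <= y by rewrite ler_piMl.
  by lra.
have x2 : 2 * x ^+ 2 <= 5 * s * y ^+ 2 + 2 * z.
  have : x ^+ 2 <= 2 * y * x by rewrite expr2 ler_wpM2r.
  have : y * x <= y * (106 / 100 * (s * y) + z) by rewrite ler_wpM2l.
  have : y * z <= z / 1000 by have := ler_wpM2r z0 y1; lra.
  have -> : y * (106 / 100 * (s * y) + z) = 106 / 100 * (s * y ^+ 2) + y * z by ring.
  by lra.
have xh : x <= 2^-1 by lra.
apply: le_trans (_ : expR (- (x + 2 * x ^+ 2)) <= _); last first.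
  by apply: le_trans (expR_le_1B xh) _; rewrite /x; lra.
rewrite ler_expR.
have -> : 192 * (80 ^+ 2 * y ^+ 3) = 3 * z by rewrite /z; ring.
have -> : s ^+ 2 - s = - (s * (1 - s)) by ring.
by rewrite /x in x2 *; lra.
Qed.

End ExponentialBounds.

(** * Squared norm of a Gaussian matrix applied to a fixed vector *)

Section ChiSquare.
Context d (T : measurableType d) (R : realType) (P : probability T R).
Context (I : finType) (W : I -> {RV P >-> R}) (n : nat).
Hypothesis indepW : mutually_independent W.
Hypothesis n0 : (0 < n)%N.
Hypothesis gaussW : forall i (B : set R), measurable B ->
  distribution P (W i) B = normal_prob 0 (Num.sqrt n%:R^-1) B.
Context (Q : finType) (h : 'I_n -> Q -> I).
Hypothesis h_inj : forall a a' q q', h a q = h a' q' -> a = a' /\ q = q'.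
Implicit Types (c : Q -> R).

(** The squared Euclidean norm of the matrix with entries [W (h a q)] applied to the vector [c]. *)
Definition quadratic_form c (w : T) : R := \sum_a (\sum_q c q * W (h a q) w) ^+ 2.

Lemma quadratic_form_ge0 c w : 0 <= quadratic_form c w.
Proof. by apply: sumr_ge0 => a _; exact: sqr_ge0. Qed.

Lemma measurable_quadratic_form c : measurable_fun setT (quadratic_form c).
Proof.
apply: measurable_sum => a; apply: measurable_funX.
by apply: measurable_sum => q; exact: measurable_funM.
Qed.

Lemma quadratic_form0 c w : \sum_q c q ^+ 2 = 0 -> quadratic_form c w = 0.
Proof.
move=> /eqP; rewrite psumr_eq0 => [/allP c0|q _]; last exact: sqr_ge0.
rewrite /quadratic_form big1// => a _; rewrite big1 ?expr0n// => q _.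
by have := c0 q (mem_index_enum q); rewrite sqrf_eq0 => /eqP ->; rewrite mul0r.
Qed.

Let nu : R := n%:R.

Let nu0 : 0 < nu.
Proof. by rewrite ltr0n. Qed.

Lemma mean_expR_quadratic_form c l : 0 < \sum_q c q ^+ 2 -> 2 * l < 1 ->
  mean P (fun w => expR (l * (nu * (quadratic_form c w / \sum_q c q ^+ 2))))
    ((1 - 2 * l) `^ (- (nu / 2))).
Proof.
set v := \sum_q _ => v0 l1.
have nun0 : nu != 0 by rewrite gt_eqF.
have vn0 : v != 0 by rewrite gt_eqF.
have sg0 : Num.sqrt nu^-1 != 0 by rewrite gt_eqF// sqrtr_gt0 invr_gt0.
have vE : \sum_q (c q * Num.sqrt nu^-1) ^+ 2 = v / nu.
  rewrite /v mulr_suml; apply: eq_bigr => q _.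
  by rewrite exprMn sqr_sqrtr// invr_ge0 ltW.
have lE : 2 * (l * nu / v) * (v / nu) = 2 * l by field; rewrite nun0 vn0.
have /= := mean_expR_quadratic indepW sg0 gaussW (c := c) (l := l * nu / v) h_inj.
rewrite vE lE card_ord => /(_ l1).
have -> : (Num.sqrt (1 - 2 * l))^-1 ^+ n = (1 - 2 * l) `^ (- (nu / 2)).
  have l0 : 0 <= 1 - 2 * l by lra.
  rewrite -powR12_sqrt// -powRN -powR_mulrn ?powR_ge0// -powRrM.
  by congr (_ `^ _); rewrite -/nu; field.
apply: eq_mean => w; congr expR; rewrite -/(quadratic_form c w).
by field.
Qed.

Lemma mean_quadratic_formX c k : 0 < \sum_q c q ^+ 2 ->
  mean P (fun w => (quadratic_form c w / \sum_q c q ^+ 2) ^+ k)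
    (\prod_(i < k) (nu + 2 * i%:R) / nu ^+ k).
Proof.
move=> v0; have nun0 : nu != 0 by rewrite gt_eqF.
have mS : measurable_fun setT
    (fun w => nu * (quadratic_form c w / \sum_q c q ^+ 2)).
  apply: measurable_funM => //; apply: measurable_funM => //.
  exact: measurable_quadratic_form.
have S0 w : 0 <= nu * (quadratic_form c w / \sum_q c q ^+ 2).
  apply: mulr_ge0; first exact: ltW.
  by apply: divr_ge0; [exact: quadratic_form_ge0|exact: ltW].
have H := mean_expM k mS S0 (fun l => mean_expR_quadratic_form v0).
rewrite mulrC; apply: eq_mean (meanZ (nu ^+ k)^-1 H) => w.
by rewrite exprMn mulrA mulVf ?mul1r// expf_neq0.
Qed.

Lemma mean_quadratic_form_powR c s : 0 <= s <= 1 -> 10 ^+ 3 <= nu ->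
  0 < \sum_q c q ^+ 2 ->
  exists2 x, mean P (fun w => (quadratic_form c w / \sum_q c q ^+ 2) `^ s) x &
    expR ((s ^+ 2 - s) / nu - 65 * s / nu ^+ 2 - 192 * (80 ^+ 2 / nu ^+ 3)) <= x
      <= expR ((s ^+ 2 - s) / nu + 3 * s / nu ^+ 2).
Proof.
move=> s01 nu3 v0; have nu1 : 1 <= nu by rewrite ler1n.
have [||x Hx /andP[lx ux]] := mean_chi_square_powR nu1 _ _
    (fun k => mean_quadratic_formX k v0) s01.
- by apply: measurable_funM => //; exact: measurable_quadratic_form.
- by move=> w; apply: divr_ge0; [exact: quadratic_form_ge0|exact: ltW].
exists x => //; apply/andP; split.
  apply: le_trans lx; rewrite -!exprVn.
  apply: chi_square_power_lower_bound => //; first by rewrite invr_ge0 ltW.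
  by rewrite mulrC ler_pdivrMr// mul1r.
apply: le_trans ux _; apply: le_trans (expR_ge1Dx _).
have -> : s * (1 - s) / nu = - ((s ^+ 2 - s) / nu) by ring.
by rewrite opprK addrA.
Qed.

(** Chernoff's bound at [l = e / 8] and [l = - (e / 8)]. By [powR_1B_le] the exponent is at most
    [nu * (4 * l ^+ 2 - e ^+ 2 / 8)], that is [- (nu * e ^+ 2 / 16)]. *)
Lemma chi_square_tail c (e : R) : 0 < e < 1 -> 0 < \sum_q c q ^+ 2 ->
  (P [set w | (e < `|quadratic_form c w / (\sum_q c q ^+ 2) - 1|)%R] <=
   (2 * expR (- (nu * e ^+ 2 / 16)))%:E)%E.
Proof.
move=> /andP[e0 e1] v0; set u := fun w => quadratic_form c w / \sum_q c q ^+ 2.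
have mu : measurable_fun setT u.
  by apply: measurable_funM => //; exact: measurable_quadratic_form.
have tail (l : R) (A : set T) : measurable A -> `|l| <= 8^-1 ->
    (forall w, A w -> `|l| * e <= l * (u w - 1)) -> `|l| = e / 8 ->
    (P A <= (expR (- (nu * e ^+ 2 / 16)))%:E)%E.
  move=> mA l8 Al lE.
  have l1 : 2 * l <= 2^-1 by move: l8; rewrite ler_norml => /andP[]; lra.
  have l2 : l ^+ 2 = e ^+ 2 / 64 by rewrite -(real_normK (num_real l)) lE; field.
  have Hl := mean_expR_quadratic_form v0 (le_lt_trans l1 (ltac:(lra) : 2^-1 < 1)).
  have := mean_markov mA Hl (fun w => expR_ge0 _)
    (expR_gt0 (nu * (l + `|l| * e))) => /(_ _)/le_trans; apply.
    move=> w /Al Aw; rewrite ler_expR mulrCA ler_wpM2l ?(ltW nu0)//.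
    by rewrite -/(u w); lra.
  rewrite lee_fin ler_pdivrMr ?expR_gt0// -expRD.
  apply: le_trans (powR_1B_le _ l1) _; first by rewrite divr_ge0// ltW.
  rewrite ler_expR exprMn l2 lE.
  by rewrite le_eqVlt; apply/orP; left; apply/eqP; field.
have mA1 : measurable [set w | e < u w - 1].
  apply: (@measurable_bool_set _ _ (fun w => e < u w - 1)).
  by apply: measurable_fun_ltr => //; exact: measurable_funB.
have mA2 : measurable [set w | u w - 1 < - e].
  apply: (@measurable_bool_set _ _ (fun w => u w - 1 < - e)).
  by apply: measurable_fun_ltr => //; exact: measurable_funB.
have -> : [set w | e < `|u w - 1|] = [set w | e < u w - 1] `|` [set w | u w - 1 < - e].
  apply/seteqP; split=> w /=.
    by rewrite ltr_normr => /orP[|]; [left|right; lra].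
  by rewrite ltr_normr => -[->//|ue]; apply/orP; right; lra.
rewrite (le_trans (measureU2 _ _ _))// mulr_natl mulr2n EFinD.
have e80 : 0 <= e / 8 by rewrite divr_ge0// ltW.
apply: leeD.
- apply: (tail (e / 8)); rewrite ?ger0_norm//; first by lra.
  by move=> w /= ew; rewrite ler_wpM2l// ltW.
- apply: (tail (- (e / 8))); rewrite ?normrN ?ger0_norm//; first by lra.
  by move=> w /= ew; rewrite mulNr -mulrN ler_wpM2l//; lra.
Qed.

End ChiSquare.

(** * Propagation through the factors of the product *)

Section DecouplingBounds.
Context d (T : measurableType d) (R : realType) (P : probability T R).
Context (I : finType) (W : I -> {RV P >-> R}).
Hypothesis indepW : mutually_independent W.
Implicit Types J K : {set I}.

(** A form of [mean_decoupling] for conditional means known only up to the factors [lo] and [hi].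
    Domination by [hi * k] provides the existence of the total mean. *)
Lemma mean_decoupling_bounds J K (f : coarse W J * coarse W K -> R) (k : T -> R)
    (lo hi x : R) :
  {in J, forall i, i \notin K} -> measurable_fun setT f ->
  (forall z, 0 <= f z) -> mean P k x ->
  (forall w, exists2 y, mean P (fun w' => f (w, w')) y &
     lo * k w <= y <= hi * k w) ->
  exists2 z, mean P (fun w => f (w, w)) z & lo * x <= z <= hi * x.
Proof.
move=> dJK mf f0 kx fk.
have mEf : measurable_fun setT (EFin \o f) by exact/measurable_EFinP.
pose g (w : T) := fine (\int[P]_w' (f (w, w'))%:E).
have fg w : mean P (fun w' => f (w, w')) (g w).
  by have [y fy _] := fk w; rewrite /g fy.2.
have gk w : lo * k w <= g w <= hi * k w.
  by have [y fy] := fk w; rewrite (mean_unique (fg w) fy).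
have g0 w : 0 <= g w by rewrite fine_ge0// integral_ge0// => ? _; rewrite lee_fin.
have mg : measurable_fun setT g.
  have Ef0 z : (0 <= (EFin \o f) z)%E by rewrite lee_fin.
  have := @decoupling_measurable _ _ _ P _ _ _ _ _ mEf Ef0.
  exact: (measurableT_comp (fine_measurable measurableT)).
have [z gz] := mean_dom mg g0 (fun w => (andP (gk w)).2) (meanZ hi kx).
exists z; first exact: (mean_decoupling indepW dJK mf).
apply/andP; split.
  exact: (mean_le (meanZ lo kx) gz (fun w => (andP (gk w)).1)).
exact: (mean_le gz (meanZ hi kx) (fun w => (andP (gk w)).2)).
Qed.

Lemma measurable_quadratic_form_pair n (Q : finType) (h : 'I_n -> Q -> I)
    (c : Q -> T -> R) J K :
  (forall q, measurable_fun setT (c q : coarse W J -> R)) ->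
  (forall a q, h a q \in K) ->
  measurable_fun setT (fun z : coarse W J * coarse W K =>
    quadratic_form W h (c ^~ z.1) z.2).
Proof.
move=> mc hK; apply: measurable_sum => a; apply: measurable_funX.
apply: measurable_sum => q; apply: measurable_funM.
  by apply: (measurableT_comp (mc q)).
by apply: measurableT_comp => //; apply: measurable_coord.
Qed.

End DecouplingBounds.

(** The case of zero coefficients is included, since both sides are then 0. *)
Lemma quadratic_form_scale d (T : measurableType d) (R : realType)
    (P : probability T R) (I : finType) (W : I -> {RV P >-> R}) n
    (Q : finType) (h : 'I_n -> Q -> I) (c : Q -> R) w :
  quadratic_form W h c w =
    (\sum_q c q ^+ 2) * (quadratic_form W h c w / \sum_q c q ^+ 2).
Proof.
have [c0|c0] := eqVneq (\sum_q c q ^+ 2) 0; first by rewrite quadratic_form0// c0 !mul0r.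
by rewrite mulrCA divff// mulr1.
Qed.

(** * Conditioning layer by layer *)

Section Layers.
Context d (T : measurableType d) (R : realType) (P : probability T R).
Context (n p m : nat) (W : 'I_m -> 'I_p.+1 -> 'I_n -> 'I_n -> {RV P >-> R}).
Hypothesis n0 : (0 < n)%N.
Hypothesis gW : gaussian_matrices W.
Context (theta : 'cV[R]_n).
Hypothesis theta1 : eucl_norm theta = 1.

Local Notation index := ('I_m * 'I_p.+1 * 'I_n * 'I_n)%type.

Let V (q : index) := W q.1.1.1 q.1.1.2 q.1.2 q.2.

Let indepV : mutually_independent V.
Proof. exact: gW.2. Qed.

Let gaussV q (B : set R) : measurable B ->
  distribution P (V q) B = normal_prob 0 (Num.sqrt n%:R^-1) B.
Proof. exact: gW.1. Qed.

Let nu : R := n%:R.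

Let nu0 : 0 < nu.
Proof. by rewrite ltr0n. Qed.

(** The image of [theta] under the first [j] factors of branch [i]. Factors are numbered from 0, so
    [inord] returns the intended index as long as [j <= p.+1]. *)
Fixpoint layer (i : 'I_m) (j : nat) (w : T) : 'cV[R]_n :=
  if j is j'.+1 then Defs.factor W i (inord j') w *m layer i j' w else theta.

Lemma factor_prod_layer i w : factor_prod W i w *m theta = layer i p.+1 w.
Proof.
(* Generalized to the product of the first [k] factors; from the left, the one in position [j] has
   index [k.-1 - j]. *)
suff H k : (k <= p.+1)%N ->
    (\big[mulmx/1%:M]_(j < k) Defs.factor W i (inord (k.-1 - j)) w) *m theta = layer i k w.
  rewrite -(H p.+1)//; congr (_ *m _); apply: eq_bigr => j _.
  by congr (Defs.factor W i _ w); apply: val_inj; rewrite /= inordK ?subSS// ltnS leq_subr.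
elim: k => [|k IH] kp; first by rewrite big_ord0 mul1mx.
rewrite big_ord_recl /= subn0 -mulmxA -IH; last exact: ltnW.
congr (_ *m (_ *m _)); apply: eq_bigr => j _.
congr (Defs.factor W i (inord _) w); rewrite /bump/=.
by rewrite add1n subnS predn_sub.
Qed.

Definition sqnorm (v : 'cV[R]_n) : R := \sum_a v a 0 ^+ 2.

Lemma sqnorm_ge0 v : 0 <= sqnorm v.
Proof. by apply: sumr_ge0 => a _; exact: sqr_ge0. Qed.

Lemma sqnorm_theta : sqnorm theta = 1.
Proof. by rewrite -[RHS](expr1n _ 2) -theta1 sqr_sqrtr// sqnorm_ge0. Qed.

Let h (i : 'I_m) (j : nat) (a b : 'I_n) : index := (i, inord j, a, b).

Let h_inj i j a a' q q' : h i j a q = h i j a' q' -> a = a' /\ q = q'.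
Proof. by move=> [-> ->]. Qed.

Lemma sqnorm_layerS i j w :
  sqnorm (layer i j.+1 w) = quadratic_form V (h i j) (fun b => layer i j w b 0) w.
Proof.
apply: eq_bigr => a _; congr (_ ^+ 2); rewrite /= mxE; apply: eq_bigr => b _.
by rewrite mxE mulrC.
Qed.

(** The entries on which [layer i j] depends; [present i j] collects those of the next factor. *)
Definition past (i : 'I_m) (j : nat) : {set index} :=
  [set q : index | (q.1.1.1 == i) && (q.1.1.2 < j)%N]%SET.

Definition present (i : 'I_m) (j : nat) : {set index} :=
  [set q : index | (q.1.1.1 == i) && (q.1.1.2 == inord j)]%SET.

Lemma past_present i j : (j <= p)%N -> {in past i j, forall q, q \notin present i j}.
Proof.
move=> jp q; rewrite !inE => /andP[_ qj]; rewrite negb_and; apply/orP; right.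
by apply: contraTneq qj => ->; rewrite inordK// ltnn.
Qed.

Lemma measurable_layer i j a : (j <= p.+1)%N ->
  measurable_fun setT ((fun w => layer i j w a 0) : coarse V (past i j) -> R).
Proof.
elim: j a => [a _|j IH a jp]; first exact: measurable_cst.
rewrite [X in measurable_fun _ X](_ : _ = (fun w =>
    \sum_b V (h i j a b) w * layer i j w b 0)); last first.
  by apply/funext => w; rewrite /= mxE; apply: eq_bigr => b _; rewrite mxE.
apply: measurable_sum => b; apply: measurable_funM.
  by apply: measurable_coord; rewrite inE /= eqxx inordK// ltnSn.
apply: (measurable_coarseS (J := past i j)); last by apply: IH; exact: ltnW.
by apply/fintype.subsetP => q; rewrite !inE => /andP[-> /ltnW].
Qed.

Lemma measurable_sqnorm_layer i j : (j <= p.+1)%N ->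
  measurable_fun setT ((fun w => sqnorm (layer i j w)) : coarse V (past i j) -> R).
Proof.
move=> jp; apply: measurable_sum => a; apply: measurable_funX.
exact: measurable_layer.
Qed.

(** Given the past, each factor multiplies the squared norm by a normalized chi-square variable
    whose law does not depend on the past, so the moments multiply. *)
Lemma mean_sqnorm_layerX i j k : (j <= p.+1)%N -> (0 < k)%N ->
  mean P (fun w => sqnorm (layer i j w) ^+ k)
    ((\prod_(r < k) (nu + 2 * r%:R) / nu ^+ k) ^+ j).
Proof.
move=> + k0; elim: j => [_|j IH jp].
  by rewrite expr0; apply: eq_mean (mean_cst P 1) => w; rewrite /= sqnorm_theta expr1n.
set M := (_ / _) in IH *.
apply: eq_mean => [w|]; first by rewrite sqnorm_layerS.
apply: (mean_decoupling indepV (J := past i j) (K := present i j)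
  (f := fun z => quadratic_form V (h i j) (fun b => layer i j z.1 b 0) z.2 ^+ k)
  (g := fun w => M * sqnorm (layer i j w) ^+ k)).
- exact: past_present.
- apply: measurable_funX.
  apply: (measurable_quadratic_form_pair (c := fun b w => layer i j w b 0)).
    by move=> b; apply: measurable_layer; exact: ltnW.
  by move=> a b; rewrite inE /= !eqxx.
- by move=> z; rewrite exprn_ge0// quadratic_form_ge0.
- move=> w /=; set c := fun b => layer i j w b 0.
  (* A vanishing layer cannot be normalized, but then both sides are 0, as [0 < k]. *)
  have [v0|v0] := eqVneq (sqnorm (layer i j w)) 0.
    rewrite v0 expr0n eqn0Ngt k0 mulr0; apply: eq_mean (mean_cst P 0) => w'.
    by rewrite quadratic_form0// expr0n eqn0Ngt k0.
  have vgt0 : 0 < \sum_b c b ^+ 2 by rewrite lt_neqAle eq_sym v0 sqnorm_ge0.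
  have := mean_quadratic_formX indepV n0 gaussV (@h_inj i j) k vgt0.
  move=> /(meanZ (sqnorm (layer i j w) ^+ k)); rewrite mulrC; apply: eq_mean => w'.
  by rewrite [in RHS]quadratic_form_scale [RHS]exprMn.
- by rewrite exprS; apply: meanZ; apply: IH; exact: ltnW.
Qed.

Lemma mean_sqnorm_layer_powR i j s : (j <= p.+1)%N -> 0 < s <= 1 -> 10 ^+ 3 <= nu ->
  exists2 x, mean P (fun w => sqnorm (layer i j w) `^ s) x &
    expR ((s ^+ 2 - s) / nu - 65 * s / nu ^+ 2 - 192 * (80 ^+ 2 / nu ^+ 3)) ^+ j <= x
      <= expR ((s ^+ 2 - s) / nu + 3 * s / nu ^+ 2) ^+ j.
Proof.
move=> jp /andP[s0 s1] nu3; set lo := expR (_ - _ - _); set hi := expR _.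
have s01 : 0 <= s <= 1 by rewrite ltW.
elim: j jp => [_|j IH jp].
  exists 1; last by rewrite !expr0 lexx.
  by apply: eq_mean (mean_cst P 1) => w; rewrite /= sqnorm_theta powR1.
have [x kx /andP[lx xh]] := IH (ltnW jp).
have [||||z fz /andP[lz zh]] := @mean_decoupling_bounds _ _ _ _ _ _ indepV
  (past i j) (present i j)
  (fun z => quadratic_form V (h i j) (fun b => layer i j z.1 b 0) z.2 `^ s)
  _ lo hi x _ _ _ kx.
- exact: past_present.
- apply: (measurableT_comp (measurable_powR _)).
  apply: (measurable_quadratic_form_pair (c := fun b w => layer i j w b 0)).
    by move=> b; apply: measurable_layer; exact: ltnW.
  by move=> a b; rewrite inE /= !eqxx.
- by move=> z; exact: powR_ge0.
- move=> w /=; set c := fun b => layer i j w b 0.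
  have [v0|v0] := eqVneq (sqnorm (layer i j w)) 0.
    exists 0; last by rewrite v0 powR0 ?gt_eqF// !mulr0 lexx.
    apply: eq_mean (mean_cst P 0) => w'.
    by rewrite quadratic_form0// powR0// gt_eqF.
  have vgt0 : 0 < \sum_b c b ^+ 2 by rewrite lt_neqAle eq_sym v0 sqnorm_ge0.
  have [y my /andP[ly yh]] :=
    mean_quadratic_form_powR indepV n0 gaussV (@h_inj i j) s01 nu3 vgt0.
  exists (sqnorm (layer i j w) `^ s * y).
    apply: eq_mean (meanZ (sqnorm (layer i j w) `^ s) my) => w'.
    rewrite [in RHS]quadratic_form_scale [RHS]powRM//; first exact: ltW.
    by apply: divr_ge0; [exact: quadratic_form_ge0|exact: ltW].
  by rewrite mulrC [hi * _]mulrC !ler_wpM2l// powR_ge0.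
exists z; first by apply: eq_mean fz => w; rewrite sqnorm_layerS.
apply/andP; split; rewrite exprS.
  by apply: le_trans lz; rewrite ler_wpM2l// expR_ge0.
by apply: (le_trans zh); rewrite ler_wpM2l// expR_ge0.
Qed.

Definition energy (w : T) : R := m%:R^-1 * \sum_i sqnorm (layer i p w).

Lemma energy_ge0 w : 0 <= energy w.
Proof.
by rewrite mulr_ge0 ?invr_ge0 ?ler0n// sumr_ge0// => i _; exact: sqnorm_ge0.
Qed.

Lemma measurable_energy : measurable_fun setT energy.
Proof.
apply: measurable_funM => //; apply: measurable_sum => i.
by apply: measurable_coarse; exact: measurable_sqnorm_layer.
Qed.

(** The last factors of all branches, side by side, form one Gaussian matrix with [n] rows and
    [m * n] columns; it acts on the stacked vector [cfin], whose squared norm is the energy. *)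
Let hfin (a : 'I_n) (q : 'I_m * 'I_n) : index := (q.1, ord_max, a, q.2).

Let hfin_inj a a' q q' : hfin a q = hfin a' q' -> a = a' /\ q = q'.
Proof. by move: q q' => [? ?] [? ?] [-> -> ->]. Qed.

Let cfin (q : 'I_m * 'I_n) (w : T) : R := (Num.sqrt m%:R)^-1 * layer q.1 p w q.2 0.

Lemma sum_cfin w : \sum_q cfin q w ^+ 2 = energy w.
Proof.
rewrite /energy mulr_sumr /cfin.
rewrite -(pair_big xpredT xpredT (fun i b => ((Num.sqrt m%:R)^-1 * layer i p w b 0) ^+ 2)).
apply: eq_bigr => i _; rewrite mulr_sumr; apply: eq_bigr => b _.
by rewrite exprMn exprVn sqr_sqrtr.
Qed.

Lemma sqnorm_prod_sum w :
  sqnorm (prod_sum W w *m theta) = quadratic_form V hfin (cfin ^~ w) w.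
Proof.
apply: eq_bigr => a _; congr (_ ^+ 2).
rewrite /prod_sum -scalemxAl mulmx_suml mxE summxE mulr_sumr /cfin.
rewrite -(pair_big xpredT xpredT (fun i b => (Num.sqrt m%:R)^-1 *
  layer i p w b 0 * V (i, ord_max, a, b) w)).
apply: eq_bigr => i _; rewrite factor_prod_layer /= mxE mulr_sumr.
apply: eq_bigr => b _; rewrite mxE (_ : inord p = ord_max); last first.
  by apply: val_inj; rewrite /= inordK.
by rewrite -mulrA [in RHS](mulrC (layer _ _ _ _ _)).
Qed.

(* Conditionally on the first [p] layers, [sqnorm (prod_sum W w *m theta)] is
   [energy w / n] times a chi-square variable with [n] degrees of freedom. *)
Lemma last_layer_tail (e : R) : 0 < e < 1 ->
  (P [set w | (e * energy w < `|sqnorm (prod_sum W w *m theta) - energy w|)%R]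
   <= (2 * expR (- (nu * e ^+ 2 / 16)))%:E)%E.
Proof.
move=> e01; have /andP[e0 _] := e01; set hi := 2 * _.
pose J : {set index} := [set q : index | (q.1.1.2 < p)%N]%SET.
pose K : {set index} := [set q : index | q.1.1.2 == ord_max]%SET.
have dJK : {in J, forall q, q \notin K}.
  by move=> q; rewrite !inE; apply: contraTneq => ->; rewrite ltnn.
have mlJ i b : measurable_fun setT ((fun w => layer i p w b 0) : coarse V J -> R).
  apply: (measurable_coarseS (J := past i p)); last exact: measurable_layer.
  by apply/fintype.subsetP => q; rewrite !inE => /andP[].
have mc q : measurable_fun setT (cfin q : coarse V J -> R).
  by apply: measurable_funM => //; exact: mlJ.
have meJ : measurable_fun setT (energy : coarse V J -> R).
  apply: measurable_funM => //; apply: measurable_sum => i.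
  by apply: measurable_sum => a; apply: measurable_funX; exact: mlJ.
pose b (z : coarse V J * coarse V K) : bool := e * energy z.1 <
  `|quadratic_form V hfin (cfin ^~ z.1) z.2 - energy z.1|.
have mb : measurable_fun setT b.
  have me1 : measurable_fun setT (fun z : coarse V J * coarse V K => energy z.1).
    exact: (measurableT_comp meJ).
  apply: measurable_fun_ltr; first exact: measurable_funM.
  apply: measurableT_comp => //; apply: measurable_funB => //.
  by apply: measurable_quadratic_form_pair => // a q; rewrite inE.
have bE w : b (w, w) = (e * energy w < `|sqnorm (prod_sum W w *m theta) - energy w|).
  by rewrite sqnorm_prod_sum.
have mbw : measurable_fun setT (fun w : T => b (w, w)).
  apply: (measurableT_comp mb); apply: measurable_fun_pair.
    by apply: (@measurable_coarse _ _ _ _ _ V _ _ J); exact: measurable_id.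
  by apply: (@measurable_coarse _ _ _ _ _ V _ _ K); exact: measurable_id.
have [|||z fz /andP[_ zh]] := @mean_decoupling_bounds _ _ _ _ _ _ indepV J K
  (fun z => if b z then 1 else 0) (fun=> 1) 0 hi 1 dJK _ _ (mean_cst P 1).
- by apply: measurable_fun_ifT.
- by move=> z; case: ifP.
(* At zero energy the form vanishes too, and the strict inequality makes the event empty. *)
- move=> w; have [e0'|e0'] := eqVneq (energy w) 0.
    exists 0; last by rewrite mul0r lexx mulr1 /hi mulr_ge0// expR_ge0.
    apply: eq_mean (mean_cst P 0) => w'.
    by rewrite /b /= quadratic_form0 ?sum_cfin// e0' subrr normr0 mulr0 ltxx.
  have ew0 : 0 < energy w by rewrite lt_neqAle eq_sym e0' energy_ge0.
  have mA : measurable [set w' : T | b (w, w')].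
    have mbK : measurable_fun setT ((fun w' => b (w, w')) : coarse V K -> bool).
      by apply: (measurableT_comp mb); exact: measurable_pair1.
    exact: (measurable_bool_set (measurable_coarse mbK)).
  have ew0' : 0 < \sum_q cfin q w ^+ 2 by rewrite sum_cfin.
  exists (fine (P [set w' : T | b (w, w')])).
    apply: eq_mean (mean_indic P mA) => w'.
    by rewrite indicE; case: ifPn => bw; [rewrite mem_set|rewrite memNset//; exact/negP].
  rewrite mul0r mulr1 fine_ge0//= -lee_fin fineK ?fin_num_measure//.
  apply: le_trans (chi_square_tail indepV n0 gaussV hfin_inj e01 ew0').
  rewrite le_eqVlt; apply/orP; left; apply/eqP; congr (P _).
  apply/funext => w' /=; congr is_true; rewrite /b /= sum_cfin.
  rewrite -ltr_pdivlMr// -[X in _ / X](ger0_norm (ltW ew0)) -normf_div.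
  by rewrite mulrBl divff.
apply: (@le_trans _ _ z%:E); last by rewrite lee_fin -[leRHS]mulr1.
apply: (mean_fin _ fz).
- by under eq_set do rewrite -bE; exact: measurable_bool_set.
- by move=> w; case: ifP.
- by move=> w /=; rewrite -bE => ->.
Qed.

End Layers.

(** * The random energy model *)

Section PairwiseIndependentSums.
Context d (T : measurableType d) (R : realType) (P : probability T R).
Implicit Types (m : nat).

(** Off-diagonal covariances vanish, so the variance of the sum is at most the sum of the second
    moments. *)
Lemma pairwise_chebyshev m (Z : 'I_m -> T -> R) (a s : 'I_m -> R) (t : R) :
  (forall i, mean P (Z i) (a i)) -> (forall i, mean P (fun w => Z i w ^+ 2) (s i)) ->
  (forall i j, i != j -> mean P (fun w => Z i w * Z j w) (a i * a j)) -> 0 < t ->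
  (P [set w | (t <= `|\sum_i Z i w - \sum_i a i|)%R] <= ((\sum_i s i) / t ^+ 2)%:E)%E.
Proof.
move=> Za Zs Zij t0.
(* The covariance matrix. *)
pose b i j := if i == j then s i - a i ^+ 2 else 0.
have H : mean P (fun w => (\sum_i Z i w - \sum_i a i) ^+ 2) (\sum_i \sum_j b i j).
  apply: (@eq_mean _ _ _ _ (fun w => \sum_i \sum_j (Z i w - a i) * (Z j w - a j))).
    by move=> w; rewrite -sumrB expr2 big_distrlr.
  apply: mean_sum => i; apply: mean_sum => j; rewrite /b.
  have E (x : R) : mean P (fun w => Z i w * Z j w) x ->
      mean P (fun w => (Z i w - a i) * (Z j w - a j)) (x - a i * a j).
    move=> ij.
    have := meanD (meanB (meanB ij (meanZ (a j) (Za i))) (meanZ (a i) (Za j)))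
      (mean_cst P (a i * a j)).
    have -> : x - a j * a i - a i * a j + a i * a j = x - a i * a j by ring.
    by apply: eq_mean => w; ring.
  case: eqVneq E => [<- E|ij E]; first by rewrite expr2; apply: E; exact: Zs.
  by rewrite -(subrr (a i * a j)); apply: E; exact: Zij.
have bE : \sum_i \sum_j b i j <= \sum_i s i.
  apply: ler_sum => i _; rewrite (bigD1 i)//= big1 => [|j ji].
    by rewrite /b eqxx addr0 lerBlDr lerDl sqr_ge0.
  by rewrite /b eq_sym (negbTE ji).
have mS : measurable_fun setT (fun w => \sum_i Z i w - \sum_i a i).
  apply: measurable_funB => //; apply: measurable_sum => i.
  exact: mean_measurable (Za i).
have mA : measurable [set w | t <= `|\sum_i Z i w - \sum_i a i|].
  apply: measurable_bool_set; apply: measurable_fun_ler => //.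
  exact: measurableT_comp.
have := mean_markov mA H (fun w => sqr_ge0 _) (exprn_gt0 2 t0) => /(_ _)/le_trans; apply.
  by move=> w /= tw; rewrite -[leRHS]real_normK ?num_real// lerXn2r// nnegrE// ltW.
by rewrite lee_fin ler_wpM2r// invr_ge0 exprn_ge0// ltW.
Qed.

(** Each ratio [y i / S] lies in [0, 1], hence is at most its power of exponent [s]; the ratios sum
    to 1. *)
Lemma powR_sum_le m (y : 'I_m -> R) (s : R) : 0 < s <= 1 -> (forall i, 0 <= y i) ->
  (\sum_i y i) `^ s <= \sum_i y i `^ s.
Proof.
move=> /andP[s0 s1] y0; set S := \sum_i y i.
have [S0|S0] := eqVneq S 0.
  by rewrite S0 powR0 ?gt_eqF// sumr_ge0// => i _; exact: powR_ge0.
have Sgt0 : 0 < S by rewrite lt_neqAle eq_sym S0 sumr_ge0.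
have -> : S `^ s = \sum_i (y i / S) * S `^ s.
  by rewrite -mulr_suml -mulr_suml divff// mul1r.
apply: ler_sum => i _.
have -> : y i `^ s = (y i / S) `^ s * S `^ s.
  by rewrite -powRM ?divr_ge0 ?(ltW Sgt0)// divfK.
apply: ler_wpM2r; first exact: powR_ge0.
have [yi0|yi0] := eqVneq (y i) 0; first by rewrite yi0 mul0r powR0// gt_eqF.
apply: ger1_powR => //; rewrite divr_gt0//=; last by rewrite lt_neqAle eq_sym yi0 y0.
rewrite ler_pdivrMr// mul1r /S (bigD1 i)//= lerDl.
by apply: sumr_ge0 => j _; exact: y0.
Qed.

(* Chernoff bounds for the law of [y] tilted by [y `^ s]. *)
Lemma powR_tilting (y s h c t : R) (b : bool) : 0 <= y -> 0 < h -> h < s -> 0 <= t ->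
  (expR (c - t) <= y <= expR (c + t) -> b) ->
  y `^ s <= expR (s * (c + t)) * b%:R +
            (expR (- (h * (c + t))) * y `^ (s + h) + expR (h * (c - t)) * y `^ (s - h)).
Proof.
move=> y0 h0 hs t0 yb.
have s0 : s != 0 by rewrite gt_eqF// (lt_trans h0).
have e0 (u v : R) : 0 <= expR u * y `^ v by rewrite mulr_ge0 ?expR_ge0 ?powR_ge0.
have [yl|yl] := ltP y (expR (c - t)).
  apply: (@le_trans _ _ (expR (h * (c - t)) * y `^ (s - h))).
    have -> : y `^ s = y `^ h * y `^ (s - h).
      have hs' : h + (s - h) = s by ring.
      by rewrite -powRD hs' // (negbTE s0).
    apply: ler_wpM2r; first exact: powR_ge0.
    rewrite mulrC expRM.
    by apply: ge0_ler_powR; rewrite ?nnegrE ?expR_ge0 ?(ltW h0) ?(ltW yl).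
  by rewrite addrA lerDr addr_ge0// mulr_ge0 ?expR_ge0.
have [yr|yr] := leP y (expR (c + t)).
  rewrite yb; last by rewrite yl.
  rewrite mulr1; apply: (@le_trans _ _ (expR (s * (c + t)))).
    rewrite mulrC expRM; apply: ge0_ler_powR; rewrite ?nnegrE ?expR_ge0//.
    by rewrite ltW// (lt_trans h0).
  by rewrite lerDl addr_ge0.
apply: (@le_trans _ _ (expR (- (h * (c + t))) * y `^ (s + h))); last first.
  by rewrite addrCA lerDl addr_ge0// mulr_ge0 ?expR_ge0.
have ygt0 : 0 < y by apply: lt_trans yr; exact: expR_gt0.
rewrite powRD ?(gt_eqF ygt0) ?implybT// mulrCA ler_peMr ?powR_ge0//.
rewrite expRN mulrC ler_pdivlMr ?expR_gt0// mul1r mulrC expRM.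
by apply: ge0_ler_powR; rewrite ?nnegrE ?expR_ge0 ?(ltW h0) ?(ltW yr).
Qed.

(** The mean of [powR_tilting]: tilted mass outside the two tails must come from the window around
    [c], where the weight is at most [expR (s * (c + t))]. *)
Lemma tilted_lower_bound (Y : T -> R) (s h c t x1 x2 x3 : R) :
  measurable_fun setT Y -> (forall w, 0 <= Y w) -> 0 < h -> h < s -> 0 <= t ->
  mean P (fun w => Y w `^ s) x1 -> mean P (fun w => Y w `^ (s + h)) x2 ->
  mean P (fun w => Y w `^ (s - h)) x3 ->
  x1 - expR (- (h * (c + t))) * x2 - expR (h * (c - t)) * x3 <=
  expR (s * (c + t)) * fine (P [set w | (expR (c - t) <= Y w <= expR (c + t))%R]).
Proof.
move=> mY Y0 h0 hs t0 Y1 Y2 Y3; set A := [set w | _].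
have mA : measurable A.
  apply: measurable_bool_set.
  by apply: measurable_and; exact: measurable_fun_ler.
have := mean_le Y1 (meanD (meanZ (expR (s * (c + t))) (mean_indic P mA))
  (meanD (meanZ (expR (- (h * (c + t)))) Y2) (meanZ (expR (h * (c - t))) Y3))).
move=> /(_ _)/[dup] H; suff : forall w, Y w `^ s <= expR (s * (c + t)) * \1_A w +
    (expR (- (h * (c + t))) * Y w `^ (s + h) + expR (h * (c - t)) * Y w `^ (s - h)).
  by move=> /H; lra.
move=> w; rewrite indicE; apply: powR_tilting => // Yw.
exact: mem_set.
Qed.

End PairwiseIndependentSums.

(** * Concentration of an average of pairwise independent weights *)

Section RandomEnergyModel.
Context d (T : measurableType d) (R : realType) (P : probability T R).
Context (m : nat) (Y : 'I_m -> T -> R).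
Hypothesis m0 : (0 < m)%N.
Hypothesis Y0 : forall i w, 0 <= Y i w.
Hypothesis mY : forall i, measurable_fun setT (Y i).
Hypothesis indepY : forall i j, i != j -> forall f g : R -> R,
  measurable_fun setT f -> measurable_fun setT g ->
  (forall x, 0 <= f x) -> (forall x, 0 <= g x) -> forall x y,
  mean P (fun w => f (Y i w)) x -> mean P (fun w => g (Y j w)) y ->
  mean P (fun w => f (Y i w) * g (Y j w)) (x * y).

Let E (w : T) := m%:R^-1 * \sum_i Y i w.
Let L : R := ln m%:R.

Let mR0 : 0 < m%:R :> R.
Proof. by rewrite ltr0n. Qed.

Let expL : expR L = m%:R.
Proof. by rewrite lnK. Qed.

Let mE : measurable_fun setT E.
Proof. by apply: measurable_funM => //; exact: measurable_sum. Qed.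

Lemma rem_chebyshev (v e : R) : 0 < e ->
  (forall i, mean P (Y i) 1) -> (forall i, mean P (fun w => Y i w ^+ 2) v) ->
  (P [set w | (e <= `|E w - 1|)%R] <= (v / e ^+ 2 * expR (- L))%:E)%E.
Proof.
move=> e0 Y1 Y2.
have Yij i j : i != j -> mean P (fun w => Y i w * Y j w) (1 * 1).
  (* [indepY] takes nonnegative test functions, so the identity is replaced by the absolute value,
     which agrees with it on the values of [Y]. *)
  have H k : mean P (fun w => `|Y k w|) 1.
    by apply: eq_mean (Y1 k) => w; rewrite ger0_norm.
  have mn : measurable_fun setT (fun x : R => `|x|) by exact: normr_measurable.
  move=> ij; apply: eq_mean (indepY ij mn mn (fun x => normr_ge0 x)
    (fun x => normr_ge0 x) (H i) (H j)) => w.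
  by rewrite !ger0_norm.
have := pairwise_chebyshev Y1 Y2 Yij (mulr_gt0 mR0 e0).
rewrite !sumr_const card_ord.
have -> : [set w | (m%:R * e <= `|\sum_i Y i w - 1 *+ m|)%R] = [set w | (e <= `|E w - 1|)%R].
  apply/funext => w /=; congr is_true; rewrite mulrC -ler_pdivlMr//.
  rewrite -[X in _ / X](ger0_norm (ltW mR0)) -normf_div mulrBl divff ?gt_eqF//.
  by rewrite /E mulrC.
move=> /le_trans; apply; rewrite lee_fin expRN expL -mulr_natl.
by rewrite le_eqVlt; apply/orP; left; apply/eqP; field; rewrite !gt_eqF.
Qed.

(** Markov's inequality for the power [s] of the sum, made additive by [powR_sum_le]. The [m] terms
    against the power [s] of [m] leave the entropy [(1 - s) * L]. *)
Lemma rem_upper_tail (s r e : R) : 0 < s <= 1 ->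
  (forall i, exists2 x, mean P (fun w => Y i w `^ s) x & x <= expR e) ->
  (P [set w | (expR r < E w)%R] <= (expR ((1 - s) * L + e - s * r))%:E)%E.
Proof.
move=> s01 Ys; have /andP[s0 s1] := s01.
have /choice[x Hx] : forall i, exists x,
    mean P (fun w => Y i w `^ s) x /\ x <= expR e.
  by move=> i; have [x ? ?] := Ys i; exists x.
have Hs : mean P (fun w => \sum_i Y i w `^ s) (\sum_i x i).
  by apply: mean_sum => i; case: (Hx i).
have mA : measurable [set w | expR r < E w].
  by apply: measurable_bool_set; exact: measurable_fun_ltr.
have c0 : 0 < expR (s * (r + L)) by exact: expR_gt0.
have := mean_markov mA Hs _ c0 => /(_ _ _)/le_trans; apply.
- by move=> w; apply: sumr_ge0 => i _; exact: powR_ge0.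
- move=> w /= rE; apply: le_trans (powR_sum_le s01 (Y0 ^~ w)).
  rewrite mulrC expRM; apply: ge0_ler_powR; rewrite ?nnegrE ?expR_ge0 ?sumr_ge0//.
    exact: ltW.
  by rewrite expRD expL -ler_pdivlMr// mulrC ltW.
- rewrite lee_fin ler_pdivrMr ?expR_gt0// -expRD.
  apply: (@le_trans _ _ (\sum_(i < m) expR e)).
    by apply: ler_sum => i _; case: (Hx i).
  rewrite sumr_const card_ord -mulr_natl -expL -expRD ler_expR.
  by rewrite le_eqVlt; apply/orP; left; apply/eqP; ring.
Qed.

(** Every index in the window contributes at least [expR (c - t)]. A small [E] thus forces the
    number of such indices below half its mean, itself at least [m%:R * q], and Chebyshev's
    inequality applies to this count. *)
Lemma rem_lower_tail (c t q : R) : 0 < q ->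
  (forall i, q <= fine (P [set w | (expR (c - t) <= Y i w <= expR (c + t))%R])) ->
  (P [set w | (E w <= q / 2 * expR (c - t))%R] <= (4 / q * expR (- L))%:E)%E.
Proof.
move=> q0 qP; pose b i w := expR (c - t) <= Y i w <= expR (c + t).
pose f (y : R) : R := if expR (c - t) <= y <= expR (c + t) then 1 else 0.
have mf : measurable_fun setT f.
  apply: measurable_fun_ifT => //.
  by apply: measurable_and; exact: measurable_fun_ler.
have f0 y : 0 <= f y by rewrite /f; case: ifP.
set a := fun i => fine (P [set w | b i w]).
have fa i : mean P (fun w => f (Y i w)) (a i).
  have mb : measurable [set w | b i w].
    by apply: measurable_bool_set; apply: measurable_and; exact: measurable_fun_ler.
  apply: eq_mean (mean_indic P mb) => w; rewrite indicE /f -/(b i w).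
  by case: (boolP (b i w)) => bw; [rewrite mem_set|rewrite memNset//; exact/negP].
have fa2 i : mean P (fun w => f (Y i w) ^+ 2) (a i).
  by apply: eq_mean (fa i) => w; rewrite /f; case: ifP => _; rewrite ?expr1n ?expr0n.
have faij i j : i != j -> mean P (fun w => f (Y i w) * f (Y j w)) (a i * a j).
  by move=> ij; exact: indepY.
have qa : m%:R * q <= \sum_i a i.
  rewrite mulr_natl -[m in _ *+ m]card_ord -sumr_const; apply: ler_sum => i _.
  exact: qP.
have mq0 : 0 < m%:R * q by exact: mulr_gt0.
set A := \sum_i a i in qa *; have A0 : 0 < A by exact: lt_le_trans qa.
have := pairwise_chebyshev fa fa2 faij (divr_gt0 A0 (ltr0Sn R 1)); rewrite -/A.
have mS : measurable_fun setT (fun w => \sum_i f (Y i w)).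
  by apply: measurable_sum => i; exact: measurableT_comp.
move=> H; apply: (@le_trans _ _ (A / (A / 2) ^+ 2)%:E); last first.
  rewrite lee_fin expRN expL.
  have -> : A / (A / 2) ^+ 2 = 4 / A by field; rewrite gt_eqF.
  rewrite -mulrA ler_wpM2l// -invfM lef_pV2 ?posrE ?mulr_gt0//.
  by rewrite mulrC.
apply: le_trans H; apply: le_measure; rewrite ?inE.
- by apply: measurable_bool_set; exact: measurable_fun_ler.
- apply: measurable_bool_set; apply: measurable_fun_ler => //.
  by apply: measurableT_comp => //; exact: measurable_funB.
move=> w /= Eq; set S := \sum_i f (Y i w).
have S2 : S <= A / 2.
  have fY : expR (c - t) * S <= \sum_i Y i w.
    rewrite mulr_sumr; apply: ler_sum => i _; rewrite /f.
    by case: ifP => [/andP[? _]|_]; rewrite ?mulr1 ?mulr0.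
  have ec0 : 0 < expR (c - t) by exact: expR_gt0.
  have {}Eq : \sum_i Y i w <= m%:R * q / 2 * expR (c - t).
    move: Eq; rewrite /E mulrC ler_pdivrMr// => /le_trans; apply.
    by rewrite le_eqVlt; apply/orP; left; apply/eqP; ring.
  have := le_trans fY Eq; rewrite mulrC ler_pM2r//; lra.
by rewrite distrC ler_normr; apply/orP; left; lra.
Qed.

End RandomEnergyModel.

(** * Application to the layers of the matrix product *)

Section Instance.
Context d (T : measurableType d) (R : realType) (P : probability T R).
Context (n p m : nat) (W : 'I_m -> 'I_p.+1 -> 'I_n -> 'I_n -> {RV P >-> R}).
Hypothesis n0 : (0 < n)%N.
Hypothesis m0 : (0 < m)%N.
Hypothesis gW : gaussian_matrices W.
Context (theta : 'cV[R]_n).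
Hypothesis theta1 : eucl_norm theta = 1.

Let nu : R := n%:R.
Let L : R := ln m%:R.
Let V : R := 2 * p%:R / nu.
Let Y (i : 'I_m) (w : T) := sqnorm (layer W theta i p w).
Let E := energy W theta.
Let S (w : T) := sqnorm (prod_sum W w *m theta).

Let nu0 : 0 < nu.
Proof. by rewrite ltr0n. Qed.

Let Y0 i w : 0 <= Y i w.
Proof. exact: sqnorm_ge0. Qed.

Let mYc i : measurable_fun setT
  (Y i : coarse (fun q : 'I_m * 'I_p.+1 * 'I_n * 'I_n => W q.1.1.1 q.1.1.2 q.1.2 q.2)
           (past n p i p) -> R).
Proof. exact: measurable_sqnorm_layer. Qed.

Let mY i : measurable_fun setT (Y i).
Proof. exact: (measurable_coarse (@mYc i)). Qed.

Let indepY i j : i != j -> forall f g : R -> R,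
  measurable_fun setT f -> measurable_fun setT g ->
  (forall x, 0 <= f x) -> (forall x, 0 <= g x) -> forall x y,
  mean P (fun w => f (Y i w)) x -> mean P (fun w => g (Y j w)) y ->
  mean P (fun w => f (Y i w) * g (Y j w)) (x * y).
Proof.
move=> ij f g mf mg f0 g0 x y fx gy.
apply: (mean_indepM gW.2 (J := past n p i p) (K := past n p j p)) => //.
- by move=> q; rewrite !inE => /andP[/eqP -> _]; rewrite (negbTE ij).
- exact: (measurableT_comp mf (@mYc i)).
- exact: (measurableT_comp mg (@mYc j)).
Qed.

Lemma measurable_sqnorm_prod_sum : measurable_fun setT S.
Proof.
rewrite (_ : S = fun w => sqnorm ((Num.sqrt m%:R)^-1 *: \sum_i layer W theta i p.+1 w)).
  apply: measurable_sum => a; apply: measurable_funX.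
  rewrite [X in measurable_fun _ X](_ : _ = (fun w =>
    (Num.sqrt m%:R)^-1 * \sum_i layer W theta i p.+1 w a 0)); last first.
    by apply/funext => w; rewrite mxE summxE.
  apply: measurable_funM => //; apply: measurable_sum => i.
  have mla := @measurable_layer _ _ _ _ _ _ _ W theta i p.+1 a (leqnn _).
  exact: (measurable_coarse mla).
apply/funext => w; rewrite /S /prod_sum -scalemxAl mulmx_suml.
by congr (sqnorm (_ *: _)); apply: eq_bigr => i _; rewrite factor_prod_layer.
Qed.

(** Outside [G] either the energy is atypical, which is [A], or the last layer distorts it by a
    relative error above [e]. *)
Let prob_union (A : set T) (G : set T) (e x : R) : 0 < e < 1 ->
  measurable A -> measurable G -> (P A <= x%:E)%E ->
  (forall w, ~ A w -> `|S w - E w| <= e * E w -> G w) ->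
  ((1 - x - 2 * expR (- (nu * e ^+ 2 / 16)))%:E <= P G)%E.
Proof.
move=> e01 mA mG PA AG.
pose B := [set w | e * E w < `|S w - E w|].
have mE : measurable_fun setT E by exact: measurable_energy.
have mB : measurable B.
  apply: measurable_bool_set; apply: measurable_fun_ltr.
    exact: measurable_funM.
  by apply: measurableT_comp => //; apply: measurable_funB => //;
    exact: measurable_sqnorm_prod_sum.
have PB : (P B <= (2 * expR (- (nu * e ^+ 2 / 16)))%:E)%E by exact: last_layer_tail.
have GAB : ~` G `<=` A `|` B.
  move=> w Gw; have [Aw|Aw] := pselect (A w); [by left|right].
  by rewrite /B /= ltNge; apply/negP => /(AG _ Aw).
have PG : (P (~` G) <= (x + 2 * expR (- (nu * e ^+ 2 / 16)))%:E)%E.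
  apply: (@le_trans _ _ (P (A `|` B))).
    by apply: le_measure; rewrite ?inE//; [exact: measurableC|exact: measurableU].
  by apply: (le_trans (measureU2 _ mA mB)); rewrite EFinD leeD.
move: PG; rewrite probability_setC// -(fineK (fin_num_measure P G mG)).
by rewrite -EFinB !lee_fin; lra.
Qed.

Let measurable_S_itv (a b : R) : measurable [set w | a <= S w <= b].
Proof.
apply: measurable_bool_set; have mS := measurable_sqnorm_prod_sum.
by apply: measurable_and; exact: measurable_fun_ler.
Qed.

(** The second moment [(1 + 2 / nu) ^+ p] is at most [expR V]. One factor [1 - e] or [1 + e] comes
    from the energy, the other from the last layer. *)
Lemma prob_small_variance (e : R) : 0 < e < 1 ->
  ((1 - e ^- 2 * expR (V - L) - 2 * expR (- (nu * e ^+ 2 / 16)))%:E <=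
   P [set w | ((1 - e) ^+ 2 <= S w <= (1 + e) ^+ 2)%R])%E.
Proof.
move=> e01; have /andP[e0 e1] := e01.
have Y1 i : mean P (Y i) 1.
  have := mean_sqnorm_layerX n0 gW theta1 i (leqnSn p) (ltn0Sn 0).
  rewrite big_ord_recl big_ord0 mulr0 addr0 mulr1 divff ?gt_eqF// expr1n.
  by apply: eq_mean.
have Y2 i : mean P (fun w => Y i w ^+ 2) ((1 + 2 / nu) ^+ p).
  have := mean_sqnorm_layerX n0 gW theta1 i (leqnSn p) (ltn0Sn 1).
  rewrite !big_ord_recl big_ord0 /= /bump /=.
  by congr (mean P _ (_ ^+ p)); field; rewrite gt_eqF.
have vV : (1 + 2 / nu) ^+ p <= expR V.
  have -> : V = 2 / nu * p%:R by rewrite /V; field; rewrite gt_eqF.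
  rewrite expRM_natr lerXn2r ?nnegrE ?expR_ge0 ?expR_ge1Dx//.
  by rewrite addr_ge0// divr_ge0// ltW.
have mE : measurable_fun setT E by exact: measurable_energy.
have := rem_chebyshev m0 Y0 indepY e0 Y1 Y2.
set A := [set w | _] => PA.
apply: (@prob_union A _ e) => //.
- apply: measurable_bool_set; apply: measurable_fun_ler => //.
  by apply: measurableT_comp => //; exact: measurable_funB.
- apply: (le_trans PA); rewrite lee_fin expRD mulrA ler_wpM2r ?expR_ge0//.
  by rewrite mulrC ler_wpM2l// invr_ge0 exprn_ge0// ltW.
- move=> w /negP; rewrite -ltNge -[m%:R^-1 * _]/(E w) ltr_norml => /andP[E1 E2].
  rewrite ler_norml => /andP[S1 S2] /=.
  have h1 : (1 - e) * (1 - e) <= (1 - e) * E w by rewrite ler_wpM2l//; lra.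
  have h2 : (1 + e) * E w <= (1 + e) * (1 + e) by rewrite ler_wpM2l//; lra.
  by rewrite !expr2; apply/andP; split; lra.
Qed.

(** [b] stands for beta and [l] for the fourth root of log m, so that the error scale is
    [b * l ^+ 3]. *)
Variables (b l : R).
Hypothesis Ll : L = l ^+ 4.
Hypothesis Vb : V = b ^+ 2 * l ^+ 4.
Hypothesis l20 : 20 <= l.
Hypothesis b7 : 7 / 10 <= b.
Hypothesis bn : b * l ^+ 2 * 10 ^+ 4 <= nu.

Let l0 : 0 < l.
Proof. by apply: lt_le_trans l20. Qed.

Let b0 : 0 < b.
Proof. by apply: lt_le_trans b7; lra. Qed.

Lemma mean_energy_powR (i : 'I_m) (s : R) : 0 < s <= 1 -> s * b <= 3 / 2 ->
  exists2 x, mean P (fun w => Y i w `^ s) x &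
    expR ((s ^+ 2 - s) * V / 2 - l ^+ 2) <= x <= expR ((s ^+ 2 - s) * V / 2 + l ^+ 2).
Proof.
move=> s01 sb; have /andP[s0 s1] := s01.
have nun0 : nu != 0 by rewrite gt_eqF.
have l2 : 1 <= l ^+ 2 by have := l20; nra.
have nu3 : 10 ^+ 3 <= nu.
  by apply: le_trans bn; have := b7; nra.
have [x Yx /andP[lx xu]] := mean_sqnorm_layer_powR n0 gW theta1 i (leqnSn p) s01 nu3.
exists x => //.
(* Over the [p] factors the errors add up to multiples of [s * V / nu] and [V / nu ^+ 2], that is of
   [s * b * l ^+ 2 * y] and [y ^+ 2], small because [y] is at most 1 / 10 ^ 4. *)
pose y := b * l ^+ 2 / nu.
have y0 : 0 <= y by rewrite divr_ge0 ?mulr_ge0 ?exprn_ge0// ltW.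
have y4 : y <= 1 / 10 ^+ 4.
  by rewrite /y ler_pdivrMr//; have := bn; lra.
have sVn : s * V / nu <= 3 / 2 * l ^+ 2 * y.
  have -> : s * V / nu = s * b * (l ^+ 2 * y) by rewrite Vb /y; field.
  by rewrite -(mulrA (3 / 2)) ler_wpM2r// mulr_ge0// exprn_ge0// ltW.
have V0 : 0 <= V by rewrite Vb mulr_ge0 ?exprn_ge0 ?(ltW b0) ?(ltW l0).
have sV0 : 0 <= s * V / nu by rewrite divr_ge0 ?(ltW nu0)// mulr_ge0// (ltW s0).
have ly : l ^+ 2 * y <= l ^+ 2 / 10 ^+ 4 by apply: ler_wpM2l => //; lra.
have Vn : V / nu ^+ 2 = y ^+ 2 by rewrite Vb /y; field.
have yy : y ^+ 2 <= 1 / 10 ^+ 4 * (1 / 10 ^+ 4) by rewrite expr2 ler_pM.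
have y20 : 0 <= y ^+ 2 by exact: sqr_ge0.
apply/andP; split.
  apply: le_trans lx; rewrite -expRM_natr ler_expR.
  have -> : ((s ^+ 2 - s) / nu - 65 * s / nu ^+ 2 - 192 * (80 ^+ 2 / nu ^+ 3)) * p%:R =
    (s ^+ 2 - s) * V / 2 - 65 / 2 * (s * V / nu) - 96 * (80 ^+ 2 * (V / nu ^+ 2)).
    by rewrite /V; field.
  by rewrite Vn; lra.
apply: (le_trans xu); rewrite -expRM_natr ler_expR.
have -> : ((s ^+ 2 - s) / nu + 3 * s / nu ^+ 2) * p%:R =
    (s ^+ 2 - s) * V / 2 + 3 / 2 * (s * V / nu).
  by rewrite /V; field.
by lra.
Qed.

(** To be taken as the minimum of [b] and the square root of 2; [gE] records that [g] equals one of
    them. Accordingly [Z2] is twice the limit, the logarithm of a squared norm. *)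
Variable g : R.
Hypothesis g7 : 7 / 10 <= g.
Hypothesis gb : g <= b.
Hypothesis g32 : g <= 3 / 2.
Hypothesis g2 : g ^+ 2 <= 2.
Hypothesis gE : (b - g) * (2 - g ^+ 2) = 0.

Let g0 : 0 < g.
Proof. by apply: lt_le_trans g7; lra. Qed.

Let Z2 : R := - ((b - g) ^+ 2 * l ^+ 4 / 2).

Let l3_ge : 20 * l ^+ 2 <= l ^+ 3.
Proof. by rewrite (exprS l 2) ler_wpM2r// ?exprn_ge0 ?(ltW l0). Qed.

Let l2_ge : 400 <= l ^+ 2.
Proof. by have := l20; nra. Qed.

Let gl3 : 7 / 10 * l ^+ 3 <= g * l ^+ 3.
Proof. by rewrite ler_wpM2r// ?exprn_ge0 ?(ltW l0). Qed.

(** With [s = g / b] the terms of order [l ^+ 4] cancel, and the slack [b * l ^+ 3] leaves the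
    exponent [l ^+ 2 - g * l ^+ 3]. *)
Lemma energy_upper_tail :
  (P [set w | (expR (Z2 + b * l ^+ 3) < E w)%R] <= (expR (- (l ^+ 3 / 2) - 3))%:E)%E.
Proof.
have bn0 : b != 0 by rewrite gt_eqF.
pose s := g / b.
have sb : s * b = g by rewrite /s divfK.
have s0 : 0 < s by rewrite divr_gt0.
have s1 : s <= 1 by rewrite ler_pdivrMr// mul1r.
have s01 : 0 < s <= 1 by rewrite s0.
have sb32 : s * b <= 3 / 2 by rewrite sb.
have Ys i : exists2 x, mean P (fun w => Y i w `^ s) x &
    x <= expR ((s ^+ 2 - s) * V / 2 + l ^+ 2).
  by have [x Yx /andP[_ xu]] := mean_energy_powR i s01 sb32; exists x.
apply: (le_trans (rem_upper_tail m0 Y0 mY (Z2 + b * l ^+ 3) s01 Ys)).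
rewrite lee_fin ler_expR -/L Ll Vb /Z2.
(* both branches of [gE] make the main terms cancel *)
have main : (1 - s) * l ^+ 4 + (s ^+ 2 - s) * (b ^+ 2 * l ^+ 4) / 2 +
    s * ((b - g) ^+ 2 * l ^+ 4 / 2) = 0.
  have -> : (1 - s) * l ^+ 4 + (s ^+ 2 - s) * (b ^+ 2 * l ^+ 4) / 2 +
    s * ((b - g) ^+ 2 * l ^+ 4 / 2) = (b - g) * (2 - g ^+ 2) / (2 * b) * l ^+ 4.
    by rewrite /s; field.
  by rewrite gE !mul0r.
have sbl : s * (b * l ^+ 3) = g * l ^+ 3 by rewrite mulrA sb.
have -> : (1 - s) * l ^+ 4 + ((s ^+ 2 - s) * (b ^+ 2 * l ^+ 4) / 2 + l ^+ 2) -
    s * (- ((b - g) ^+ 2 * l ^+ 4 / 2) + b * l ^+ 3) = l ^+ 2 - g * l ^+ 3.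
  by rewrite mulrDr mulrN sbl; lra.
by have := l3_ge; have := l2_ge; have := gl3; lra.
Qed.

Lemma energy_lower_tail :
  (P [set w | (E w <= expR (Z2 - 9 * (b * l ^+ 3)))%R] <=
   (expR (- (l ^+ 3 / 2) - 3))%:E)%E.
Proof.
have bn0 : b != 0 by rewrite gt_eqF.
have ln0 : l != 0 by rewrite gt_eqF.
have bl0 : 0 < b * l by exact: mulr_gt0.
have lI : l^-1 <= 20^-1 by rewrite lef_pV2 ?posrE.
have lI0 : 0 < l^-1 by rewrite invr_gt0.
(* Scales chosen so that [h * t = 9 * l ^+ 2] beats [h ^+ 2 * V / 2 = 9 / 2 * l ^+ 2] together with
   the two moment errors [l ^+ 2], while [s - h] and [s + h] stay in (0, 1]. The level [c] is the
   mean of the logarithm of [Y i] under the tilted law, in the Gaussian approximation. *)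
pose h := 3 / (b * l); pose s := (g - 6 / l) / b; pose t := 3 * b * l ^+ 3.
pose c := (s - 2^-1) * V.
have h0 : 0 < h by rewrite divr_gt0.
have t0 : 0 <= t by rewrite !mulr_ge0 ?exprn_ge0// ltW.
have hE : h = 3 / l / b by rewrite /h; field; rewrite bn0 ln0.
have shE : s + h = (g - 3 / l) / b by rewrite /s hE; field; rewrite bn0 ln0.
have smE : s - h = (g - 9 / l) / b by rewrite /s hE; field; rewrite bn0 ln0.
have hs : h < s.
  by rewrite -subr_gt0 smE divr_gt0//; have := g7; lra.
have s0 : 0 < s by exact: lt_trans hs.
have [sh0 sm0] : 0 < s + h /\ 0 < s - h by split; lra.
have sh1 : s + h <= 1.
  by rewrite shE ler_pdivrMr// mul1r; have := gb; lra.
have shb : (s + h) * b <= 3 / 2 by rewrite shE divfK//; have := g32; lra.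
have sb : s * b <= 3 / 2 by apply: le_trans shb; rewrite ler_wpM2r ?(ltW b0)// lerDl (ltW h0).
have smb : (s - h) * b <= 3 / 2.
  by apply: le_trans sb; rewrite ler_wpM2r ?(ltW b0)// gerBl (ltW h0).
have hV : h ^+ 2 * V / 2 = 9 / 2 * l ^+ 2 by rewrite Vb hE; field; rewrite bn0 ln0.
have ht : h * t = 9 * l ^+ 2 by rewrite /t hE; field; rewrite bn0 ln0.
(* The shift [6 / l] in [s] is what yields the gain [3 * g * l ^+ 3]: it keeps [m%:R * q] large even
   when [g ^+ 2 = 2]. *)
pose q := 2^-1 * expR (- (g ^+ 2 * l ^+ 4 / 2) + 3 * g * l ^+ 3 - l ^+ 2).
have q0 : 0 < q by rewrite mulr_gt0 ?expR_gt0.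
have qP i : q <= fine (P [set w | (expR (c - t) <= Y i w <= expR (c + t))%R]).
  have [x1 Y1 /andP[l1 _]] : exists2 x, mean P (fun w => Y i w `^ s) x &
      expR ((s ^+ 2 - s) * V / 2 - l ^+ 2) <= x <= expR ((s ^+ 2 - s) * V / 2 + l ^+ 2).
    by apply: mean_energy_powR => //; rewrite s0; lra.
  have [x2 Y2 /andP[_ u2]] : exists2 x, mean P (fun w => Y i w `^ (s + h)) x &
      expR (((s + h) ^+ 2 - (s + h)) * V / 2 - l ^+ 2) <= x <=
      expR (((s + h) ^+ 2 - (s + h)) * V / 2 + l ^+ 2).
    by apply: mean_energy_powR => //; rewrite sh0.
  have [x3 Y3 /andP[_ u3]] : exists2 x, mean P (fun w => Y i w `^ (s - h)) x &
      expR (((s - h) ^+ 2 - (s - h)) * V / 2 - l ^+ 2) <= x <=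
      expR (((s - h) ^+ 2 - (s - h)) * V / 2 + l ^+ 2).
    by apply: mean_energy_powR => //; rewrite sm0; lra.
  have := tilted_lower_bound c (@mY i) (Y0 i) h0 hs t0 Y1 Y2 Y3.
  set F := fine _ => HF.
  pose M := expR ((s ^+ 2 - s) * V / 2 - l ^+ 2).
  have M0 : 0 < M by exact: expR_gt0.
  have small : expR (- (5 / 2 * l ^+ 2)) <= 4^-1.
    rewrite expRN lef_pV2 ?posrE ?expR_gt0//.
    by apply: le_trans (expR_ge1Dx _); have := l2_ge; lra.
  (* Each tail takes at most a quarter of the tilted mass, so half of [M] remains for the window. *)
  have b2 : expR (- (h * (c + t))) * x2 <= M / 4.
    apply: (@le_trans _ _ (M * expR (- (5 / 2 * l ^+ 2)))); last first.
      by rewrite ler_wpM2l// ltW.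
    apply: le_trans (ler_wpM2l (expR_ge0 _) u2) _; rewrite -!expRD ler_expR.
    rewrite le_eqVlt; apply/orP; left; apply/eqP.
    transitivity ((s ^+ 2 - s) * V / 2 + h ^+ 2 * V / 2 - h * t + l ^+ 2).
      by rewrite /c; field.
    by rewrite hV ht; field.
  have b3 : expR (h * (c - t)) * x3 <= M / 4.
    apply: (@le_trans _ _ (M * expR (- (5 / 2 * l ^+ 2)))); last first.
      by rewrite ler_wpM2l// ltW.
    apply: le_trans (ler_wpM2l (expR_ge0 _) u3) _; rewrite -!expRD ler_expR.
    rewrite le_eqVlt; apply/orP; left; apply/eqP.
    transitivity ((s ^+ 2 - s) * V / 2 + h ^+ 2 * V / 2 - h * t + l ^+ 2).
      by rewrite /c; field.
    by rewrite hV ht; field.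
  have HM : M / 2 <= expR (s * (c + t)) * F by rewrite -/M in l1; lra.
  have qE : q = expR (- (s * (c + t))) * (M / 2).
    rewrite /q mulrC mulrA -expRD; congr (expR _ / _).
    have st : s * t = 3 * (g * l - 6) * l ^+ 2.
      by rewrite /s /t; field; rewrite bn0 ln0.
    have s2V : s ^+ 2 * V = (g * l - 6) ^+ 2 * l ^+ 2.
      by rewrite Vb /s; field; rewrite bn0 ln0.
    have -> : - (s * (c + t)) + ((s ^+ 2 - s) * V / 2 - l ^+ 2) =
        - (s ^+ 2 * V / 2) - s * t - l ^+ 2 by rewrite /c; field.
    by rewrite st s2V; lra.
  rewrite qE; apply: le_trans (ler_wpM2l (expR_ge0 _) HM) _.
  by rewrite mulrA -expRD addNr expR0 mul1r.
have := rem_lower_tail m0 Y0 mY indepY q0 qP.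
have -> : 4 / q * expR (- ln m%:R) =
    8 * expR (g ^+ 2 * l ^+ 4 / 2 - 3 * g * l ^+ 3 + l ^+ 2 - l ^+ 4).
  have -> : g ^+ 2 * l ^+ 4 / 2 - 3 * g * l ^+ 3 + l ^+ 2 - l ^+ 4 =
    - (- (g ^+ 2 * l ^+ 4 / 2) + 3 * g * l ^+ 3 - l ^+ 2) + - L.
    by rewrite Ll; ring.
  rewrite /q -/L; set X := _ - l ^+ 2; rewrite (expRD (- X)) (expRN X); field.
  by rewrite gt_eqF// expR_gt0.
have mE : measurable_fun setT E by exact: measurable_energy.
have e8 : 8 <= expR 7 :> R by apply: le_trans (expR_ge1Dx _); lra.
have gl4 : g ^+ 2 * l ^+ 4 / 2 <= l ^+ 4.
  by rewrite ler_pdivrMr// mulrC ler_wpM2l// exprn_ge0 ?(ltW l0).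
have gl3' : 3 * g * l ^+ 3 = 3 * (g * l ^+ 3) by rewrite mulrA.
move=> H; apply: le_trans (le_trans H _); last first.
  rewrite lee_fin; apply: le_trans (ler_wpM2r (expR_ge0 _) e8) _.
  rewrite -expRD ler_expR gl3'.
  by have := l3_ge; have := l2_ge; have := gl3; lra.
apply: le_measure; rewrite ?inE.
- by apply: measurable_bool_set; exact: measurable_fun_ler.
- by apply: measurable_bool_set; exact: measurable_fun_ler.
move=> w /= /le_trans; apply.
have e4 : 4 <= expR 3 :> R by apply: le_trans (expR_ge1Dx _); lra.
(* The coefficient 9 is 6 from the shift in [s] plus 3 from [t]; the surplus
   [3 * g * l ^+ 3 - l ^+ 2] absorbs the factor [4^-1]. *)
have -> : q / 2 * expR (c - t) =
    4^-1 * expR (Z2 - 9 * (b * l ^+ 3) + (3 * g * l ^+ 3 - l ^+ 2)).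
  have -> : Z2 - 9 * (b * l ^+ 3) + (3 * g * l ^+ 3 - l ^+ 2) =
    (- (g ^+ 2 * l ^+ 4 / 2) + 3 * g * l ^+ 3 - l ^+ 2) + (c - t).
    by rewrite /Z2 /c /t Vb /s; field; rewrite bn0 ln0.
  by rewrite /q; set X := _ - l ^+ 2; rewrite (expRD X); field.
rewrite ler_pdivlMl// mulrC (expRD (_ - 9 * _)); apply: ler_wpM2l; first exact: expR_ge0.
apply: (le_trans e4); rewrite ler_expR gl3'.
by have := l3_ge; have := l2_ge; have := gl3; lra.
Qed.

(** The last layer is controlled with the fixed accuracy [2^-1], since a constant factor is
    negligible at the scale [b * l ^+ 3]. *)
Lemma prob_large_variance :
  ((1 - 2 * expR (- (l ^+ 3 / 2) - 3) - 2 * expR (- (nu / 64)))%:E <=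
   P [set w | (expR (Z2 - 9 * (b * l ^+ 3)) / 2 <= S w <=
               3 / 2 * expR (Z2 + b * l ^+ 3))%R])%E.
Proof.
have h01 : 0 < (2^-1 : R) < 1 by apply/andP; split; lra.
have -> : nu / 64 = nu * 2^-1 ^+ 2 / 16 by field.
have mE : measurable_fun setT E by exact: measurable_energy.
apply: (@prob_union ([set w | expR (Z2 + b * l ^+ 3) < E w] `|`
  [set w | E w <= expR (Z2 - 9 * (b * l ^+ 3))]) _ 2^-1) => //.
- apply: measurableU; apply: measurable_bool_set.
    exact: measurable_fun_ltr.
  exact: measurable_fun_ler.
- apply: (le_trans (measureU2 _ _ _)).
  + by apply: measurable_bool_set; exact: measurable_fun_ltr.
  + by apply: measurable_bool_set; exact: measurable_fun_ler.
  + rewrite [2 * _]mulr_natl mulr2n EFinD.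
    exact: leeD energy_upper_tail energy_lower_tail.
- move=> w /not_orP[/= /negP E1 /negP E2].
  rewrite -leNgt in E1; rewrite -ltNge in E2.
  by rewrite ler_norml => /andP[S1 S2]; apply/andP; split; lra.
Qed.

End Instance.

(** * The two regimes of beta *)

Section LogNorm.
Context {R : realType}.
Implicit Types (x y e : R).

Lemma ln_1D_bound e x : 0 < e < 1 -> 1 - e <= x <= 1 + e -> `|ln x| <= e / (1 - e).
Proof.
move=> /andP[e0 e1] /andP[x1 x2]; have x0 : 0 < x by lra.
have e1' : 0 < 1 - e by lra.
have ee : e <= e / (1 - e) by rewrite ler_pdivlMr// ler_piMr ?(ltW e0)//; lra.
rewrite ler_norml; apply/andP; split.
  rewrite lerNl -lnV ?posrE//.
  have xI : x^-1 <= 1 + e / (1 - e).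
    have -> : 1 + e / (1 - e) = (1 - e)^-1 by field; rewrite gt_eqF.
    by rewrite lef_pV2 ?posrE.
  apply: le_trans (_ : ln (1 + e / (1 - e)) <= _).
    by rewrite ler_ln ?posrE ?invr_gt0//; lra.
  by apply: le_ln1Dx; lra.
apply: le_trans ee; apply: le_trans (_ : ln (1 + e) <= _).
  by rewrite ler_ln ?posrE//; lra.
by apply: le_ln1Dx; lra.
Qed.

Lemma ln_sqrt_bound x y1 y2 : expR y1 <= x <= expR y2 ->
  0 < Num.sqrt x /\ y1 / 2 <= ln (Num.sqrt x) <= y2 / 2.
Proof.
move=> /andP[x1 x2]; have x0 : 0 < x by exact: lt_le_trans (expR_gt0 _) x1.
split; first by rewrite sqrtr_gt0.
rewrite -powR12_sqrt ?(ltW x0)// ln_powR [2^-1 * _]mulrC.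
rewrite !ler_pM2r// -[y1]expRK -[y2]expRK.
by rewrite !ler_ln ?posrE ?expR_gt0// x1 x2.
Qed.

End LogNorm.

Lemma measurable_pos_le d (T : measurableType d) (R : realType) (X : T -> R)
    (f : R -> R) (r : R) :
  measurable_fun setT X -> measurable_fun setT f ->
  measurable [set w | 0 < X w /\ f (X w) <= r].
Proof.
move=> mX mf.
have -> : [set w | 0 < X w /\ f (X w) <= r] = [set w | (0 < X w) && (f (X w) <= r)].
  by apply/seteqP; split=> w /andP.
apply: measurable_bool_set; apply: measurable_and; first exact: measurable_fun_ltr.
by apply: measurable_fun_ler => //; exact: (measurableT_comp mf).
Qed.

Section NonAsymptotic.
Context d (T : measurableType d) (R : realType) (P : probability T R).
Context (n p m : nat) (W : 'I_m -> 'I_p.+1 -> 'I_n -> 'I_n -> {RV P >-> R}).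
Hypothesis n0 : (0 < n)%N.
Hypothesis m1 : (1 < m)%N.
Hypothesis gW : gaussian_matrices W.
Context (theta : 'cV[R]_n).
Hypothesis theta1 : eucl_norm theta = 1.

Let nu : R := n%:R.
Let L : R := ln m%:R.
Let b : R := beta_param R n p.+1 m.
Let Z : R := Z_limit R n p.+1 m.
Let X (w : T) := eucl_norm (prod_sum W w *m theta).

Let m0 : (0 < m)%N.
Proof. exact: ltnW. Qed.

Let nu0 : 0 < nu.
Proof. by rewrite ltr0n. Qed.

Let L0 : 0 < L.
Proof. by rewrite ln_gt0// ltr1n. Qed.

Let b0 : 0 <= b.
Proof. by rewrite divr_ge0. Qed.

Lemma sqr_beta_param : 2 * p%:R / nu = b ^+ 2 * L.
Proof.
rewrite /b /beta_param -[p.+1%:R]natr1 addrK exprMn exprVn !sqr_sqrtr; last first.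
- by rewrite mulr_ge0.
- by rewrite mulr_ge0// ltW.
by rewrite -/nu -/L; field; rewrite !gt_eqF.
Qed.

Let mX : measurable_fun setT X.
Proof.
rewrite (_ : X = fun w => Num.sqrt (sqnorm (prod_sum W w *m theta)))//.
rewrite [X in measurable_fun _ X](_ : _ =
    fun w => sqnorm (prod_sum W w *m theta) `^ 2^-1); last first.
  by apply/funext => w; rewrite powR12_sqrt// sqnorm_ge0.
have mS := @measurable_sqnorm_prod_sum _ _ _ _ _ _ _ W theta.
exact: (measurableT_comp (measurable_powR _) mS).
Qed.

Let measurable_ln_bound (a r : R) :
  measurable [set w | 0 < X w /\ a * `|ln (X w) - Z| <= r].
Proof.
apply: (@measurable_pos_le _ _ _ X (fun x => a * `|ln x - Z|)) => //.
apply: measurable_funM => //; apply: measurableT_comp => //.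
by apply: measurable_funB => //; exact: measurable_ln.
Qed.

(** The bound on [b] gives [b ^+ 2 <= 1 / 2], so the exponent [V - L] of Chebyshev's bound is at
    most [- (L / 2)]. The weight [a] lets both regimes use the result. *)
Lemma prob_small_beta (e r a : R) : 0 < e < 1 -> b <= 7 / 10 -> 0 <= a ->
  a * (e / (1 - e)) <= r ->
  ((1 - e ^- 2 * expR (- (L / 2)) - 2 * expR (- (nu * e ^+ 2 / 16)))%:E <=
   P [set w | (0 < X w /\ a * `|ln (X w) - Z| <= r)%R])%E.
Proof.
move=> e01 b7 a0 ar; have /andP[e0 e1] := e01.
have Z0 : Z = 0.
  rewrite /Z /Z_limit -/b ifT//; apply: (le_trans b7).
  by rewrite -[leLHS]ger0_norm -?sqrtr_sqr ?ler_sqrt//; lra.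
apply: (@le_trans _ _ (P [set w |
    ((1 - e) ^+ 2 <= sqnorm (prod_sum W w *m theta) <= (1 + e) ^+ 2)%R])).
  apply: le_trans (prob_small_variance n0 m0 gW theta1 e01).
  rewrite lee_fin lerD2r lerD2l lerN2 ler_wpM2l ?invr_ge0 ?exprn_ge0 ?(ltW e0)//.
  rewrite ler_expR sqr_beta_param -/L.
  have : b ^+ 2 <= 1 / 2.
    by apply: (@le_trans _ _ (7 / 10 * (7 / 10))); [rewrite expr2 ler_pM|lra].
  by move=> /(ler_wpM2r (ltW L0)); lra.
have mS := @measurable_sqnorm_prod_sum _ _ _ _ _ _ _ W theta.
apply: le_measure; rewrite ?inE; last move=> w /= /andP[S1 S2].
- by apply: measurable_bool_set; apply: measurable_and; exact: measurable_fun_ler.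
- exact: measurable_ln_bound.
have h1 : 1 - e <= X w by rewrite -[leLHS]ger0_norm -?sqrtr_sqr ?ler_sqrt ?sqnorm_ge0//; lra.
have h2 : X w <= 1 + e.
  by rewrite -[leRHS]ger0_norm -?sqrtr_sqr ?ler_sqrt ?sqr_ge0//; lra.
split; first by lra.
apply: le_trans ar; rewrite Z0 subr0 ler_wpM2l//.
by apply: ln_1D_bound => //; rewrite h1.
Qed.

Lemma prob_large_beta (l r a : R) : L = l ^+ 4 -> 20 <= l -> 7 / 10 <= b ->
  b * l ^+ 2 * 10 ^+ 4 <= nu -> 0 <= a -> a * (5 * (b * l ^+ 3)) <= r ->
  ((1 - 2 * expR (- (l ^+ 3 / 2) - 3) - 2 * expR (- (nu / 64)))%:E <=
   P [set w | (0 < X w /\ a * `|ln (X w) - Z| <= r)%R])%E.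
Proof.
move=> Ll l20 b7 bn a0 ar.
have s2 : Num.sqrt (2 : R) ^+ 2 = 2 by rewrite sqr_sqrtr.
have s20 : 0 <= Num.sqrt (2 : R) by exact: sqrtr_ge0.
have s27 : 7 / 10 <= Num.sqrt (2 : R) by rewrite leNgt; apply/negP => ?; nra.
have s232 : Num.sqrt (2 : R) <= 3 / 2 by rewrite leNgt; apply/negP => ?; nra.
pose g := Num.min b (Num.sqrt 2).
have gs : g <= Num.sqrt 2 by rewrite ge_min lexx orbT.
have gb : g <= b by rewrite ge_min lexx.
have g7 : 7 / 10 <= g by rewrite le_min b7.
have g32 : g <= 3 / 2 by exact: le_trans s232.
have g2 : g ^+ 2 <= 2 by rewrite -s2 lerXn2r// nnegrE; lra.
have gE : (b - g) * (2 - g ^+ 2) = 0.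
  rewrite /g minElt; case: ifP => _; first by rewrite subrr mul0r.
  by rewrite s2 subrr mulr0.
have ZE : Z = - ((b - g) ^+ 2 * l ^+ 4 / 2) / 2.
  rewrite /Z /Z_limit -/b -/L Ll /g; have [bs|bs] := leP b (Num.sqrt 2).
    by rewrite subrr expr0n/= !mul0r oppr0 mul0r.
  by field.
have Vb : 2 * p%:R / nu = b ^+ 2 * l ^+ 4 by rewrite sqr_beta_param Ll.
have := prob_large_variance n0 m0 gW theta1 Ll Vb l20 b7 bn g7 gb g32 g2 gE.
set z := - (_ / 2) in ZE *; move=> /le_trans; apply.
pose S w := sqnorm (prod_sum W w *m theta).
have mS : measurable_fun setT S by exact: measurable_sqnorm_prod_sum.
apply: le_measure; rewrite ?inE; last move=> w /= /andP[S1 S2].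
- by apply: measurable_bool_set; apply: measurable_and; exact: measurable_fun_ler.
- exact: measurable_ln_bound.
have bl1 : 1 <= b * l ^+ 3.
  have l3 : 20 ^+ 3 <= l ^+ 3 by rewrite lerXn2r ?nnegrE//; lra.
  apply: (@le_trans _ _ (7 / 10 * l ^+ 3)); first by lra.
  by rewrite ler_wpM2r//; lra.
have e2 : 2 <= expR 1 :> R by apply: le_trans (expR_ge1Dx _); lra.
(* The constants 1/2 and 3/2 become a shift by 1. Halving the logarithm leaves at most [(9 * (b * l
   ^+ 3) + 1) / 2 <= 5 * (b * l ^+ 3)]. *)
have : expR (z - 9 * (b * l ^+ 3) - 1) <= S w <= expR (z + b * l ^+ 3 + 1).
  apply/andP; split.
    apply: le_trans S1; rewrite (expRD (_ - 9 * _)) expRN.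
    by apply: ler_wpM2l; [exact: expR_ge0|rewrite lef_pV2 ?posrE ?expR_gt0].
  apply: (le_trans S2); rewrite (expRD (z + _)) mulrC.
  by apply: ler_wpM2l; [exact: expR_ge0|lra].
move=> /ln_sqrt_bound[X0 /andP[X1 X2]]; split => //.
apply: le_trans ar; apply: ler_wpM2l => //.
rewrite -[X w]/(Num.sqrt (S w)) ZE ler_norml; apply/andP; split; lra.
Qed.

End NonAsymptotic.

(** * Explicit sufficient conditions for the two regimes *)

Section AsymptoticRegimes.
Context (R : realType) (n N m : nat).
Hypothesis n0 : (0 < n)%N.
Hypothesis N0 : (0 < N)%N.
Hypothesis m1 : (1 < m)%N.

Let beta : R := beta_param R n N m.
Let Z : R := Z_limit R n N m.
Let logm : R := ln m%:R.

Context d (T : measurableType d) (P : probability T R).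
Context (W : 'I_m -> 'I_N -> 'I_n -> 'I_n -> {RV P >-> R}).
Hypothesis gW : gaussian_matrices W.
Context (theta : 'cV[R]_n) (eps : R).
Hypothesis theta1 : eucl_norm theta = 1.
Hypothesis eps01 : 0 < eps < 1.

Let eps0 : 0 < eps.
Proof. by case/andP: eps01. Qed.

Let eps1 : eps < 1.
Proof. by case/andP: eps01. Qed.

Let logm0 : 0 < logm.
Proof. by rewrite ln_gt0// ltr1n. Qed.

Lemma small_beta_regime : beta <= 7 / 10 ->
  ((1 - eps ^- 2 * expR (- (64^-1 * logm))
      - 2 * expR (- (64^-1 * n%:R * eps ^+ 2)))%R%:E <=
   P [set w | (0 < eucl_norm (prod_sum W w *m theta)
        /\ `|ln (eucl_norm (prod_sum W w *m theta)) - Z| <=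
             5 * (eps / (1 - eps) + beta ^+ 2 * logm / n%:R))%R])%E.
Proof.
rewrite /beta /Z; move: W gW N0; case: N => // p W' gW' _ b7.
have r0 : 1 * (eps / (1 - eps)) <=
    5 * (eps / (1 - eps) + beta_param R n p.+1 m ^+ 2 * logm / n%:R).
  have : 0 <= eps / (1 - eps) by rewrite divr_ge0 ?subr_ge0 ?ltW.
  have : 0 <= beta_param R n p.+1 m ^+ 2 * logm / n%:R.
    by rewrite divr_ge0// mulr_ge0 ?sqr_ge0// ltW.
  by lra.
have := prob_small_beta n0 m1 gW' theta1 eps01 b7 ler01 r0.
under [X in P X]eq_set do rewrite mul1r.
apply: le_trans; rewrite lee_fin.
have nu0 : 0 <= n%:R * eps ^+ 2 by rewrite mulr_ge0 ?sqr_ge0.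
apply: lerB; first apply: lerB => //.
- rewrite ler_wpM2l ?invr_ge0 ?exprn_ge0 ?(ltW eps0)// ler_expR -/logm.
  by have := logm0; lra.
- by rewrite ler_wpM2l// ler_expR -mulrA; lra.
Qed.

Let l : R := logm `^ (1 / 4).

Let l4 : logm = l ^+ 4.
Proof.
rewrite /l -powR_mulrn ?powR_ge0// -powRrM (_ : 1 / 4 * 4%:R = 1) ?powRr1 ?ltW//.
by field.
Qed.

Let l3 : logm `^ (3 / 4) = l ^+ 3.
Proof.
by rewrite /l -powR_mulrn ?powR_ge0// -powRrM; congr (_ `^ _); field.
Qed.

(** Since [eps < 1], a failure probability free of [eps] suffices, obtained with accuracy [2^-1].
    Values of beta up to 7 / 10 go through [prob_small_beta], whose constant error is at most
    [beta * l ^+ 3]; larger values go through [prob_large_beta]. *)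
Lemma large_beta_regime : 0 < beta -> 20 <= l -> 1 <= beta * l ^+ 3 ->
  2 * 10 ^+ 8 * N%:R <= n%:R ^+ 3 :> R ->
  ((1 - (1 + eps ^- 2) * expR (- (64^-1 * logm `^ (3 / 4)))
      - 2 * expR (- (64^-1 * n%:R * eps ^+ 2)))%R%:E <=
   P [set w | (0 < eucl_norm (prod_sum W w *m theta)
        /\ (beta ^+ 2 * logm)^-1
             * `|ln (eucl_norm (prod_sum W w *m theta)) - Z| <=
             5 * (eps / ((1 - eps) * beta * logm)
                  + (beta * logm `^ (1 / 4))^-1))%R])%E.
Proof.
move=> b0 l20 bl1 Nn; rewrite l3 -/l.
have l0 : 0 < l by apply: lt_le_trans l20.
have ln0 : l != 0 by rewrite gt_eqF.
have bn0 : beta != 0 by rewrite gt_eqF.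
have nu0 : 0 < n%:R :> R by rewrite ltr0n.
set a := (beta ^+ 2 * logm)^-1; set r := 5 * _.
have a0 : 0 <= a by rewrite invr_ge0 mulr_ge0 ?sqr_ge0 ?ltW.
have r1 : 5 / (beta * l) <= r.
  rewrite /r ler_wpM2l// lerDr divr_ge0 ?(ltW eps0)// !mulr_ge0 ?(ltW b0) ?(ltW logm0)//.
  by rewrite subr_ge0 ltW.
have bl0 : 0 < beta * l by exact: mulr_gt0.
have aE : a * (beta * l ^+ 3) = (beta * l)^-1.
  by rewrite /a l4; field; rewrite bn0 ln0.
have l3_0 : 0 <= l ^+ 3 by rewrite exprn_ge0// ltW.
have fail : 2 * expR (- (n%:R / 64)) <= 2 * expR (- (64^-1 * n%:R * eps ^+ 2)).
  rewrite ler_wpM2l// ler_expR.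
  have : n%:R * eps ^+ 2 <= n%:R :> R.
    by rewrite ler_piMr ?(ltW nu0)// expr_le1 ?ltW.
  by lra.
have eps2 : 1 <= 1 + eps ^- 2 by rewrite lerDl invr_ge0 exprn_ge0// ltW.
have fail2 x : x <= expR (- (64^-1 * l ^+ 3)) ->
    x <= (1 + eps ^- 2) * expR (- (64^-1 * l ^+ 3)).
  move=> /le_trans; apply; rewrite -[leLHS]mul1r ler_wpM2r// expR_ge0.
suff : ((1 - expR (- (64^-1 * l ^+ 3)) - 2 * expR (- (n%:R / 64)))%:E <=
    P [set w | (0 < eucl_norm (prod_sum W w *m theta)
      /\ a * `|ln (eucl_norm (prod_sum W w *m theta)) - Z| <= r)%R])%E.
  apply: le_trans; rewrite lee_fin; apply: lerB => //.
  by apply: lerB => //; exact: fail2.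
have l43 : 20 * l ^+ 3 <= l ^+ 4 by rewrite (exprS l 3) ler_wpM2r.
have l30 : 20 ^+ 3 <= l ^+ 3 by rewrite lerXn2r ?nnegrE// ltW.
move: b0 l20 bl1 Nn l0 ln0 bn0 a0 r1 bl0 aE l3_0 l43 l30.
rewrite /r {r} /a {a} /beta /Z; move: W gW N0; case: N => // p W' gW' _.
set b := beta_param _ _ _ _; set a := (_ * logm)^-1; set r := 5 * (_ + _).
move=> b0 l20 bl1 Nn l0 ln0 bn0 a0 r1 bl0 aE l3_0 l43 l30.
have [b7|b7] := leP b (7 / 10).
  have h01 : 0 < (2^-1 : R) < 1 by apply/andP; split; lra.
  have ar : a * (2^-1 / (1 - 2^-1)) <= r.
    apply: le_trans r1; rewrite (_ : 2^-1 / _ = 1) ?mulr1; last by field.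
    apply: (@le_trans _ _ (a * (b * l ^+ 3))); first by rewrite ler_peMr.
    rewrite aE -[leLHS]mul1r ler_wpM2r ?invr_ge0 ?(ltW bl0)//; lra.
  apply: le_trans (prob_small_beta n0 m1 gW' theta1 h01 b7 a0 ar).
  rewrite lee_fin (_ : n%:R * 2^-1 ^+ 2 / 16 = n%:R / 64); last by field.
  rewrite lerD2r lerD2l lerN2.
  have e4 : 2^-1 ^- 2 <= expR 3 :> R.
    rewrite -exprVn invrK; apply: le_trans (expR_ge1Dx _); lra.
  apply: le_trans (ler_wpM2r (expR_ge0 _) e4) _.
  by rewrite -expRD ler_expR -/logm l4; lra.
have ar : a * (5 * (b * l ^+ 3)) <= r by rewrite mulrCA aE.
(* After squaring, [b ^+ 2 * l ^+ 4 = 2 * p%:R / n%:R] turns this into the cubic condition on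
   [n]. *)
have bl2 : b * l ^+ 2 * 10 ^+ 4 <= n%:R.
  rewrite -(@ler_pXn2r _ 2)// ?nnegrE ?(ltW nu0)//; last first.
    by rewrite mulr_ge0 ?exprn_ge0// mulr_ge0 ?exprn_ge0 ?(ltW b0) ?(ltW l0).
  have -> : (b * l ^+ 2 * 10 ^+ 4) ^+ 2 = b ^+ 2 * logm * 10 ^+ 8 by rewrite l4; ring.
  rewrite -(@sqr_beta_param R n p m n0 m1) mulrAC ler_pdivrMr//.
  rewrite -exprSr; apply: le_trans Nn.
  by rewrite -natr1; have : 0 <= p%:R :> R by []; lra.
have := prob_large_beta n0 m1 gW' theta1 l4 l20 (ltW b7) bl2 a0 ar.
apply: le_trans; rewrite lee_fin lerD2r lerD2l lerN2.
have e2 : 2 <= expR 1 :> R by apply: le_trans (expR_ge1Dx _); lra.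
apply: le_trans (ler_wpM2r (expR_ge0 _) e2) _.
by rewrite -expRD ler_expR; lra.
Qed.

End AsymptoticRegimes.

Lemma near_le_ln (R : realType) (m : nat -> nat) (A : R) :
  m k @[k --> \oo] --> \oo -> \forall k \near \oo, A <= ln (m k)%:R.
Proof.
move=> /cvgnyPge cm; have := cm (Num.truncn (expR A)).+1.
apply: filterS => k mk; have mA : expR A <= (m k)%:R.
  by apply: le_trans (ltW (truncnS_gt _)) _; rewrite ler_nat.
by rewrite -[A]expRK ler_ln ?posrE ?expR_gt0// (lt_le_trans (expR_gt0 A)).
Qed.

Theorem theorem1 (R : realType) :
  exists c C : R, [/\ 0 < c, 0 < C &
  forall n N m : nat -> nat,
    n k @[k --> \oo] --> \oo ->
    N k @[k --> \oo] --> \oo ->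
    m k @[k --> \oo] --> \oo ->
    let beta := fun k => beta_param R (n k) (N k) (m k) in
    let Z := fun k => Z_limit R (n k) (N k) (m k) in
    let logm := fun k => ln (m k)%:R : R in
    (beta k @[k --> \oo] --> (0 : R) ->
     \forall k \near \oo,
       forall (d : measure_display) (T : measurableType d) (P : probability T R)
         (W : 'I_(m k) -> 'I_(N k) -> 'I_(n k) -> 'I_(n k) -> {RV P >-> R}),
       gaussian_matrices W ->
       forall (theta : 'cV[R]_(n k)) (eps : R),
         eucl_norm theta = 1 -> 0 < eps < 1 ->
         ((1 - eps ^- 2 * expR (- (c * logm k))
             - 2 * expR (- (c * (n k)%:R * eps ^+ 2)))%R%:E <=
          P [set w | (0 < eucl_norm (prod_sum W w *m theta)
               /\ `|ln (eucl_norm (prod_sum W w *m theta)) - Z k| <=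
                    C * (eps / (1 - eps) + beta k ^+ 2 * logm k / (n k)%:R))%R])%E)
    /\
    ((exists b : R, 0 < b /\ \forall k \near \oo, b <= beta k) ->
     logm =o_\oo (fun k => (N k)%:R `^ (1 / 3) : R) ->
     (fun k => (N k)%:R : R) =o_\oo (fun k => (n k)%:R ^+ 3 : R) ->
     \forall k \near \oo,
       forall (d : measure_display) (T : measurableType d) (P : probability T R)
         (W : 'I_(m k) -> 'I_(N k) -> 'I_(n k) -> 'I_(n k) -> {RV P >-> R}),
       gaussian_matrices W ->
       forall (theta : 'cV[R]_(n k)) (eps : R),
         eucl_norm theta = 1 -> 0 < eps < 1 ->
         ((1 - (1 + eps ^- 2) * expR (- (c * logm k `^ (3 / 4)))
             - 2 * expR (- (c * (n k)%:R * eps ^+ 2)))%R%:E <=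
          P [set w | (0 < eucl_norm (prod_sum W w *m theta)
               /\ (beta k ^+ 2 * logm k)^-1
                    * `|ln (eucl_norm (prod_sum W w *m theta)) - Z k| <=
                    C * (eps / ((1 - eps) * beta k * logm k)
                         + (beta k * logm k `^ (1 / 4))^-1))%R])%E)].
Proof.
(* The rate 1/64 is [e ^+ 2 / 16] at [e = 2^-1], and 5 is the constant of [prob_large_beta]. *)
exists 64^-1, 5; split; [by rewrite invr_gt0|by []|].
move=> n N m cn cN cm beta Z logm.
have n_gt0 : \forall k \near \oo, (0 < n k)%N by move/cvgnyPge : cn; apply.
have N_gt0 : \forall k \near \oo, (0 < N k)%N by move/cvgnyPge : cN; apply.
have m_gt1 : \forall k \near \oo, (1 < m k)%N by move/cvgnyPge : cm; apply.
split=> [beta0|[b [b0 bbeta]] _ No].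
  have beta7 : \forall k \near \oo, beta k < 7 / 10.
    by apply: (cvgr_lt _ beta0); lra.
  near=> k => d T P W gW theta eps theta1 eps01.
  by apply: small_beta_regime => //; [near: k..|apply: ltW; near: k].
have cube : \forall k \near \oo, 2 * 10 ^+ 8 * (N k)%:R <= (n k)%:R ^+ 3 :> R.
  have e0 : 0 < (2 * 10 ^+ 8)^-1 :> R by rewrite invr_gt0 mulr_gt0// exprn_gt0.
  move/eqoP : No => /(_ _ e0); apply: filterS => k.
  rewrite !ger0_norm ?exprn_ge0//.
  by rewrite -ler_pdivlMl ?invr_gt0 ?mulr_gt0 ?exprn_gt0// invrK.
(* A lower bound [A] on the fourth root of log m: at least 20 as the tail estimates require, and
   above [b^-1] so that [beta * l ^+ 3 >= b * l >= 1]. *)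
have [A A20 Ab] : exists2 A : R, 20 <= A & 1 + b^-1 <= A.
  by exists (Num.max 20 (1 + b^-1)); rewrite le_max lexx ?orbT.
have lA : \forall k \near \oo, A ^+ 4 <= logm k by exact: near_le_ln.
near=> k => d T P W gW theta eps theta1 eps01.
have bk : b <= beta k by near: k.
have A0 : 0 <= A by lra.
have Al : A <= logm k `^ (1 / 4).
  have -> : A = (A ^+ 4) `^ (1 / 4).
    have e1 : 4%:R * (1 / 4) = 1 :> R by field.
    by rewrite -powR_mulrn// -powRrM e1 powRr1.
  have Ak : A ^+ 4 <= logm k by near: k.
  apply: ge0_ler_powR => //; rewrite ?nnegrE ?exprn_ge0//.
  by apply: le_trans Ak; rewrite exprn_ge0.
apply: large_beta_regime => //; try by near: k.
- exact: lt_le_trans bk.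
- exact: le_trans Al.
set l := (_ `^ _) in Al *.
have l1 : 1 <= l by lra.
have bl : b^-1 <= l by lra.
apply: (@le_trans _ _ (b * b^-1)); first by rewrite divff// gt_eqF.
apply: ler_pM => //; [exact: ltW|by rewrite invr_ge0 ltW|].
apply: (le_trans bl); rewrite -[leLHS]expr1; exact: ler_weXn2l.
Unshelve. all: by end_near.
Qed.
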